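(* Let $A$ be a trunc and $L$ a pointed frame. For any truncation morphism $\theta:A\rightarrow\mathcal{R}_0L$ there is a unique pointed frame morphism $g:\mathcal{M}A\rightarrow L$ such that $\mathcal{R}_0g\circ\mu_A=\theta$.
   Context: Frames are assumed completely regular. All $\ell$-groups are divisible abelian lattice-ordered groups, and $A^+=\{a\in A:a\geq 0\}$. A trunc is an $\ell$-group $A$ with a unary operation $a\mapsto\overline{a}$ on $A^+$ such that for all $a,b\in A^+$: (T1) $a\wedge\overline{b}\leq\overline{a}\leq a$; (T2) $\overline{a}=0$ implies $a=0$; (T3) if $na=\overline{na}$ for all $n\in\mathbb{N}$ (positive integers) then $a=0$; (T4) $\bigcap_{n\in\mathbb{N}}(a\ominus n)^{\bot\bot}=0$. Here, for $a\in A^+$, $a\ominus r=a-r\,\overline{a/r}$ for rational $r>0$, and $a\ominus 0=a$; $B^\bot=\{x\in A:|x|\wedge|b|=0\text{ for all }b\in B\}$. Truncs are automatically archimedean. $\overline{A}=\{\overline{a}:a\in A^+\}$. A truncation morphism between truncs is an $\ell$-homomorphism $f$ with $f(\overline{a})=\overline{f(a)}$ for $a\geq 0$. A truncation kernel of $A$ is the set of elements sent to $0$ by some truncation morphism from $A$ into a trunc. $\mathcal{K}A$ is the set of truncation kernels ordered by inclusion; it is a frame, with meet given by intersection and join of a family the truncation kernel generated by its union. $[B]$ denotes the smallest truncation kernel containing $B\subseteq A$. For $a\in A^+$ and rational $r\geq 0$, $a\blacktriangleright r=[a\ominus r]$ and $a\blacktriangleleft r=\bigvee_{0<s<r}(a\ominus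 s)^\bot$, $s$ rational, the join taken in $\mathcal{K}A$ (polars are truncation kernels). $2=\{\bot,\top\}$ is the two-element frame. A pointed frame is a frame $M$ with a designated frame map (point) $\ast_M:M\to 2$; a pointed frame morphism is a frame map commuting with the points. The spectrum of $A$ is the pointed frame $\mathcal{M}A=2_F\mathcal{K}A=\{(\varepsilon,K)\in 2\times\mathcal{K}A:\varepsilon=\top\Rightarrow K\in F\}$ (a subframe of the product frame), with point $(\varepsilon,K)\mapsto\varepsilon$, where $F$ is the filter on $\mathcal{K}A$ generated by the kernels $a\blacktriangleleft 1$, $a\in\overline{A}$. For a frame $L$, $\mathcal{R}L$ is the set of frame maps $\mathcal{O}\mathbb{R}\to L$ ($\mathcal{O}\mathbb{R}$ the topology of $\mathbb{R}$). It is an $\ell$-group under the standard operations: for $\diamond\in\{+,\vee,\wedge\}$, $(f\diamond g)(U)=\bigvee\{f(U_1)\wedge g(U_2):U_1\diamond U_2\subseteq U\}$; $(-f)(U)=f(-U)$; zero is the constant map $0$, where the constant map $r$ sends $U$ to $\top$ if $r\in U$ and to $\bot$ otherwise. It is a trunc with $\overline{f}=f\wedge 1$ for $f\geq 0$. For a pointed frame $M$, $\mathcal{R}_0M$ is the subtrunc $\{f\in\mathcal{R}M:\ast_M\circ f=0\}$, where $0:\mathcal{O}\mathbb{R}\to 2$ sends $U$ to $\top$ iff $0\in U$. For a pointed frame morphism $g:M\to L$, $\mathcal{R}_0g:\mathcal{R}_0M\to\mathcal{R}_0L$ is $f\mapsto g\circ f$. $\mu_A:A\to\mathcal{R}_0\mathcal{M}A$,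 $a\mapsto\widehat{a}$, is the unique truncation morphism such that for $a\in A^+$ and rational $r$, $\widehat{a}(r,\infty)=(\bot,a\blacktriangleright r)$ if $r\geq 0$ and $\widehat{a}(r,\infty)=(\top,\top)$ if $r<0$. *)

(* Defs.v *)
From HB Require Import structures.
From mathcomp Require Import all_boot all_order all_algebra.
From mathcomp Require Import all_classical all_reals all_analysis.

Set Implicit Arguments.
Unset Strict Implicit.
Unset Printing Implicit Defensive.

Import Order.TTheory GRing.Theory Num.Theory.
Import numFieldNormedType.Exports.

Local Open Scope classical_set_scope.
Local Open Scope ring_scope.
Local Open Scope order_scope.

Reserved Notation "x \glb y" (at level 48, left associativity).
Reserved Notation "x \lub y" (at level 52, left associativity).

(* Order.Lattice and GRing.Zmodule have no common HB extension below
   Num.RealDomain, hence the meet and join given here on porderZmodType. *)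
HB.mixin Record POrderedZmodule_isDivisibleLGroup A
    of Num.POrderedZmodule A := {
  glb : A -> A -> A;
  lub : A -> A -> A;
  lexglb : forall x y z : A, (x <= glb y z) = (x <= y) && (x <= z);
  lublex : forall x y z : A, (lub x y <= z) = (x <= z) && (y <= z);
  lg_leD2r : forall x y z : A, x <= y -> x + z <= y + z;
  lg_divisible : forall (n : nat) (x : A), (0 < n)%N -> exists y : A, y *+ n = x
}.

#[short(type="divLGroupType")]
HB.structure Definition DivisibleLGroup :=
  { A of POrderedZmodule_isDivisibleLGroup A & Num.POrderedZmodule A }.

Notation "x \glb y" := (glb x y) : order_scope.
Notation "x \lub y" := (lub x y) : order_scope.

Definition lg_abs (A : divLGroupType) (x : A) : A := x \lub - x.

(* q x for rational q: an l-group is torsion-free, so y is unique; it exists by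
   divisibility. *)
Definition ratmul (A : divLGroupType) (q : rat) (x : A) : A :=
  xget 0 [set y | y *~ denq q = x *~ numq q].

Definition polar (A : divLGroupType) (B : set A) : set A :=
  [set x | forall b, B b -> lg_abs x \glb lg_abs b = 0].

(* $a \ominus r = a - r\overline{a/r}$, with tr as the truncation. *)
Definition ominus_of (A : divLGroupType) (tr : A -> A) (a : A) (r : rat) : A :=
  if r == 0 then a else a - ratmul r (tr (ratmul r^-1 a)).

(* trunc is total, but its values outside A^+ are unconstrained and never used. *)
HB.mixin Record DivisibleLGroup_isTrunc A of DivisibleLGroup A := {
  trunc : A -> A;
  trunc_ge0 : forall a, 0 <= a -> 0 <= trunc a;
  truncT1 : forall a b, 0 <= a -> 0 <= b ->
    a \glb trunc b <= trunc a /\ trunc a <= a;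
  truncT2 : forall a, 0 <= a -> trunc a = 0 -> a = 0;
  truncT3 : forall a, 0 <= a ->
    (forall n, (0 < n)%N -> a *+ n = trunc (a *+ n)) -> a = 0;
  truncT4 : forall a, 0 <= a ->
    \bigcap_(n in [set n : nat | (0 < n)%N])
      polar (polar [set ominus_of trunc a n%:R]) = [set 0]
}.

#[short(type="truncType")]
HB.structure Definition Trunc :=
  { A of DivisibleLGroup_isTrunc A & DivisibleLGroup A }.

Definition ominus (A : truncType) (a : A) (r : rat) : A := ominus_of trunc a r.

Record truncation_morphism (A B : truncType) (f : A -> B) : Prop := {
  tmorD : {morph f : x y / x + y};
  tmorI : {morph f : x y / x \glb y};
  tmorU : {morph f : x y / x \lub y};
  tmorT : forall a, 0 <= a -> f (trunc a) = trunc (f a)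
}.

Definition truncation_kernel (A : truncType) (K : set A) : Prop :=
  exists (B : truncType) (f : A -> B),
    truncation_morphism f /\ K = [set a | f a = 0].

Section LGroupTheory.
Variable A : divLGroupType.
Implicit Types x y z a b c u v : A.

Let lexI x y z : (x <= y \glb z) = (x <= y) && (x <= z). Proof. exact: lexglb. Qed.
Let leUx x y z : (x \lub y <= z) = (x <= z) && (y <= z). Proof. exact: lublex. Qed.

Lemma lg_leIl x y : x \glb y <= x.
Proof. by have := lexx (x \glb y); rewrite lexI => /andP[]. Qed.

Lemma lg_leIr x y : x \glb y <= y.
Proof. by have := lexx (x \glb y); rewrite lexI => /andP[]. Qed.

Lemma lg_leUl x y : x <= x \lub y.
Proof. by have := lexx (x \lub y); rewrite leUx => /andP[]. Qed.

Lemma lg_leUr x y : y <= x \lub y.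
Proof. by have := lexx (x \lub y); rewrite leUx => /andP[]. Qed.

Lemma lg_glbC x y : x \glb y = y \glb x.
Proof. by apply/le_anti; rewrite !lexI !lg_leIl !lg_leIr. Qed.

Lemma lg_lubC x y : x \lub y = y \lub x.
Proof. by apply/le_anti; rewrite !leUx !lg_leUl !lg_leUr. Qed.

Lemma lg_glb_id x y : x <= y -> x \glb y = x.
Proof. by move=> xy; apply/le_anti; rewrite lexI lg_leIl lexx. Qed.

Lemma lg_lub_id x y : y <= x -> x \lub y = x.
Proof. by move=> xy; apply/le_anti; rewrite leUx lg_leUl lexx xy. Qed.

Lemma lg_le2r z x y : (x + z <= y + z) = (x <= y).
Proof.
apply/idP/idP; last exact: lg_leD2r.
by move/(lg_leD2r _ _ (- z)); rewrite !addrK.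
Qed.

Lemma lg_le2l z x y : (z + x <= z + y) = (x <= y).
Proof. by rewrite ![z + _]addrC lg_le2r. Qed.

Lemma lg_lerBl x y z : (x - y <= z) = (x <= z + y).
Proof. by rewrite -(lg_le2r y (x - y)) subrK. Qed.

Lemma lg_lerBr x y z : (x <= y - z) = (x + z <= y).
Proof. by rewrite -(lg_le2r z x (y - z)) subrK. Qed.

Lemma lg_leN x y : (- x <= - y) = (y <= x).
Proof. by rewrite -(lg_le2r (x + y) (- x)) addKr addrCA addNr addr0. Qed.

Lemma lg_subr_ge0 x y : (0 <= x - y) = (y <= x).
Proof. by rewrite lg_lerBr add0r. Qed.

Lemma lg_oppr_le0 x : (- x <= 0) = (0 <= x).
Proof. by rewrite -{1}[0]oppr0 lg_leN. Qed.

Lemma lg_oppr_ge0 x : (0 <= - x) = (x <= 0).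
Proof. by rewrite -{1}[0]oppr0 lg_leN. Qed.

Lemma lg_leD x y u v : x <= y -> u <= v -> x + u <= y + v.
Proof.
move=> xy uv; apply: (@le_trans _ _ (y + u)); first by rewrite lg_le2r.
by rewrite lg_le2l.
Qed.

Lemma lg_addr_ge0 x y : 0 <= x -> 0 <= y -> 0 <= x + y.
Proof. by move=> x0 y0; rewrite -[0]addr0 lg_leD. Qed.

Lemma lg_ler_wpDr x y : 0 <= y -> x <= x + y.
Proof. by move=> y0; rewrite -{1}[x]addr0 lg_le2l. Qed.

Lemma lg_addUr x y z : (x \lub y) + z = (x + z) \lub (y + z).
Proof.
apply/le_anti/andP; split; last by rewrite leUx !lg_le2r lg_leUl lg_leUr.
by rewrite -lg_lerBr leUx !lg_lerBr lg_leUl lg_leUr.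
Qed.

Lemma lg_addIr x y z : (x \glb y) + z = (x + z) \glb (y + z).
Proof.
apply/le_anti/andP; split; first by rewrite lexI !lg_le2r lg_leIl lg_leIr.
by rewrite -lg_lerBl lexI !lg_lerBl lg_leIl lg_leIr.
Qed.

Lemma lg_oppU x y : - (x \lub y) = (- x) \glb (- y).
Proof.
apply/le_anti/andP; split; first by rewrite lexI !lg_leN lg_leUl lg_leUr.
by rewrite -lg_leN opprK leUx -lg_leN opprK lg_leIl -lg_leN opprK lg_leIr.
Qed.

Lemma lg_oppI x y : - (x \glb y) = (- x) \lub (- y).
Proof. by rewrite -[x]opprK -[y]opprK -lg_oppU !opprK. Qed.

Lemma lg_mulrn_ge0 x n : 0 <= x -> 0 <= x *+ n.
Proof.
by move=> x0; elim: n => [|n IH]; rewrite ?mulr0n // mulrS lg_addr_ge0.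
Qed.

Lemma lg_lerMn2r x y n : x <= y -> x *+ n <= y *+ n.
Proof.
by move=> xy; rewrite -lg_subr_ge0 -mulrnBl lg_mulrn_ge0 // lg_subr_ge0.
Qed.

Lemma lg_lerMn x n : 0 <= x -> (0 < n)%N -> x <= x *+ n.
Proof. by case: n => // n x0 _; rewrite mulrS lg_ler_wpDr // lg_mulrn_ge0. Qed.

Lemma lg_meetDl u b c : 0 <= u -> 0 <= b -> 0 <= c ->
  u \glb (b + c) <= u \glb b + u \glb c.
Proof.
move=> u0 b0 c0; set t := u \glb (b + c).
have tu : t <= u by rewrite lg_leIl.
have tbc : t <= b + c by rewrite lg_leIr.
rewrite -lg_lerBl lexI; apply/andP; split.
  by rewrite lg_lerBl (le_trans tu) // lg_ler_wpDr // lexI u0.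
rewrite lg_lerBl addrC -lg_lerBl lexI !lg_lerBl [c + b]addrC tbc andbT.
by rewrite (le_trans tu) // lg_ler_wpDr.
Qed.

Lemma lg_meetMn u b n : 0 <= u -> 0 <= b -> u \glb (b *+ n) <= (u \glb b) *+ n.
Proof.
move=> u0 b0; elim: n => [|n IH]; first by rewrite !mulr0n lg_leIr.
rewrite !mulrS (le_trans (lg_meetDl _ _ _)) ?lg_mulrn_ge0 //.
by rewrite lg_le2l.
Qed.

Lemma lg_disjMn b c n m : 0 <= b -> 0 <= c -> b \glb c = 0 ->
  (b *+ n) \glb (c *+ m) = 0.
Proof.
move=> b0 c0 bc; apply/le_anti.
rewrite lexI !lg_mulrn_ge0 // andbT.
rewrite (le_trans (lg_meetMn _ _ _)) ?lg_mulrn_ge0 // lg_glbC.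
rewrite (le_trans (lg_lerMn2r m (lg_meetMn n c0 b0))) //.
by rewrite lg_glbC bc !mul0rn.
Qed.

Definition lg_pos x := x \lub 0.

Lemma lg_pos_ge0 x : 0 <= lg_pos x. Proof. exact: lg_leUr. Qed.

Lemma lg_pos_id x : 0 <= x -> lg_pos x = x.
Proof. exact: lg_lub_id. Qed.

Lemma lg_posP x y : 0 <= y -> (lg_pos x <= y) = (x <= y).
Proof. by move=> y0; rewrite leUx y0 andbT. Qed.

Lemma lg_pos_mono x y : x <= y -> lg_pos x <= lg_pos y.
Proof. by move=> xy; rewrite leUx lg_leUr andbT (le_trans xy) // lg_leUl. Qed.

Lemma lg_le_posDl x y : x <= lg_pos x + lg_pos y.
Proof. by rewrite -[x in x <= _]addr0 lg_leD ?lg_leUl ?lg_leUr. Qed.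

Lemma lg_le_posDr x y : y <= lg_pos x + lg_pos y.
Proof. by rewrite addrC lg_le_posDl. Qed.

Lemma lg_posE x : x = lg_pos x - lg_pos (- x).
Proof.
apply/eqP; rewrite -subr_eq opprK; apply/eqP.
by rewrite addrC lg_addUr addNr add0r lg_lubC.
Qed.

Lemma lg_pos_disj x : lg_pos x \glb lg_pos (- x) = 0.
Proof.
have px : lg_pos x = x + lg_pos (- x).
  by rewrite {2}[x]lg_posE subrK.
have -> : lg_pos (- x) = 0 + lg_pos (- x) by rewrite add0r.
rewrite {1}px -lg_addIr.
have -> : x \glb 0 = - lg_pos (- x) by rewrite lg_oppU opprK oppr0.
by rewrite addNr.
Qed.

Lemma lg_pMn_ge0 x n : (0 < n)%N -> 0 <= x *+ n -> 0 <= x.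
Proof.
move=> n0; rewrite {1}[x]lg_posE mulrnBl lg_subr_ge0 => nm.
have := lg_disjMn n n (lg_pos_ge0 x) (lg_pos_ge0 (- x)) (lg_pos_disj x).
rewrite lg_glbC lg_glb_id // => nm0.
have : lg_pos (- x) <= 0 by rewrite -nm0 lg_lerMn // lg_pos_ge0.
by move=> m0; rewrite [x]lg_posE lg_subr_ge0 (le_trans m0) // lg_pos_ge0.
Qed.

Lemma lg_pMn2r x y n : (0 < n)%N -> (x *+ n <= y *+ n) = (x <= y).
Proof.
move=> n0; apply/idP/idP; last exact: lg_lerMn2r.
rewrite -(lg_subr_ge0 (y *+ n)) -mulrnBl => /(lg_pMn_ge0 n0).
by rewrite lg_subr_ge0.
Qed.

Lemma lg_pMnI x y n : (0 < n)%N -> x *+ n = y *+ n -> x = y.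
Proof.
move=> n0 e; apply/le_anti.
by rewrite -(lg_pMn2r x y n0) -(lg_pMn2r y x n0) e lexx.
Qed.

Lemma lg_abs_ge0 x : 0 <= lg_abs x.
Proof.
apply: (@lg_pMn_ge0 _ 2) => //; rewrite mulr2n.
by rewrite -(subrr x) lg_leD // ?lg_leUl ?lg_leUr.
Qed.

Lemma lg_abs_id x : 0 <= x -> lg_abs x = x.
Proof.
by move=> x0; rewrite /lg_abs lg_lub_id // (le_trans _ x0) // lg_oppr_le0.
Qed.

Lemma lg_absN x : lg_abs (- x) = lg_abs x. Proof. by rewrite /lg_abs opprK lg_lubC. Qed.

Lemma lg_absP x y : (lg_abs x <= y) = (x <= y) && (- x <= y).
Proof. exact: leUx. Qed.

Lemma lg_le_abs x : x <= lg_abs x. Proof. exact: lg_leUl. Qed.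

Lemma lg_leN_abs x : - x <= lg_abs x. Proof. exact: lg_leUr. Qed.

Lemma lg_abs0_eq0 x : lg_abs x = 0 -> x = 0.
Proof.
move=> e; apply/le_anti; rewrite -{1}e lg_le_abs /=.
by rewrite -lg_oppr_le0 -e lg_leN_abs.
Qed.

Lemma lg_abs0 : lg_abs (0 : A) = 0. Proof. by rewrite lg_abs_id. Qed.

Lemma lg_absB x y : lg_abs (x - y) <= lg_abs x + lg_abs y.
Proof.
rewrite lg_absP opprB lg_leD ?lg_le_abs ?lg_leN_abs //=.
by rewrite addrC lg_leD ?lg_le_abs ?lg_leN_abs.
Qed.

Lemma lg_abs_pos x : lg_pos x <= lg_abs x.
Proof. by rewrite lg_posP ?lg_abs_ge0 // lg_le_abs. Qed.

Lemma lg_abs_mono x y : 0 <= x -> x <= y -> lg_abs x <= lg_abs y.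
Proof. by move=> x0 xy; rewrite !lg_abs_id // (le_trans x0). Qed.

Lemma lg_subI x y : x - (x \glb y) = lg_pos (x - y).
Proof. by rewrite lg_oppI addrC lg_addUr addNr lg_lubC addrC. Qed.

Lemma ratmul_unique q x y : y *~ denq q = x *~ numq q -> ratmul q x = y.
Proof.
move=> e; apply: xget_unique => // z /=; rewrite -e.
have := denq_gt0 q; case: (denq q) => // -[//|d] _.
exact: lg_pMnI.
Qed.

Lemma ratmul_nat n x : ratmul n%:R x = x *+ n.
Proof.
apply: ratmul_unique.
have -> : (n%:R : rat) = n%:Z%:~R by [].
by rewrite denq_int numq_int.
Qed.

Lemma ratmul_invn n x y : (0 < n)%N -> y *+ n = x -> ratmul n%:R^-1 x = y.
Proof.
case: n => // n _ e; apply: ratmul_unique.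
have -> : (n.+1%:R : rat) = n.+1%:Z%:~R by [].
have d : denq (n.+1%:Z%:~R^-1) = n.+1%:Z by rewrite denqVz.
have -> : numq (n.+1%:Z%:~R^-1) = 1.
  by apply: (@intr_inj rat); rewrite numqE d mulVf // intr_eq0.
by rewrite d -e.
Qed.

End LGroupTheory.

Section TruncAxiom4.
Variables (A : divLGroupType) (tr : A -> A).
Hypothesis tr_ge0 : forall a, 0 <= a -> 0 <= tr a.
Hypothesis trT1 : forall a b, 0 <= a -> 0 <= b ->
  a \glb tr b <= tr a /\ tr a <= a.

Lemma ominus_ofE a b n : (0 < n)%N -> b *+ n = a ->
  ominus_of tr a n%:R = (b - tr b) *+ n.
Proof.
move=> n0 e; rewrite /ominus_of pnatr_eq0 eqn0Ngt n0 /= (ratmul_invn n0 e).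
by rewrite ratmul_nat -e mulrnBl.
Qed.

Hypothesis trT2 : forall a, 0 <= a -> tr a = 0 -> a = 0.

Lemma polar0 (B : set A) : polar B 0.
Proof. by move=> b _; rewrite lg_abs0 lg_glb_id // lg_abs_ge0. Qed.

Lemma trunc_polars0 (a : A) :
  (forall x, 0 <= x -> (forall n, x *+ n <= a) -> x = 0) -> 0 <= a ->
  \bigcap_(n in [set n : nat | (0 < n)%N])
      polar (polar [set ominus_of tr a n%:R]) = [set 0].
Proof.
move=> arch a0; apply/seteqP; split=> [x xP|_ ->]; last first.
  by move=> n _; exact: polar0.
have X0 := lg_abs_ge0 x; set X := lg_abs x in X0 *.
apply: lg_abs0_eq0; rewrite -/X; apply: (trT2 X0).
apply: arch => [|[|n]]; [exact: tr_ge0|by rewrite mulr0n|].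
have [b e] := lg_divisible n.+1 a isT.
have b0 : 0 <= b by apply: (@lg_pMn_ge0 _ _ n.+1) => //; rewrite e.
rewrite -e lg_pMn2r // -(lg_subr_ge0 b) -lg_oppr_le0 opprB.
pose y := lg_pos (tr X - b).
have y0 : 0 <= y := lg_pos_ge0 _.
have bt0 : 0 <= b - tr b by rewrite lg_subr_ge0; have [] := trT1 b0 b0.
have yb : y \glb (b - tr b) = 0.
  apply/le_anti; rewrite lexglb y0 bt0 !andbT -(lg_pos_disj (tr X - b)).
  rewrite lexglb lg_leIl (le_trans (lg_leIr _ _)) // opprB.
  by rewrite -lg_subI lg_le2l lg_leN; have [] := trT1 b0 X0.
have yX : y <= X.
  rewrite lg_posP // lg_lerBl (@le_trans _ _ X) ?lg_ler_wpDr //.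
  by have [] := trT1 X0 X0.
have yp : polar [set ominus_of tr a n.+1%:R] y.
  move=> _ ->; rewrite (ominus_ofE _ e) // !lg_abs_id ?lg_mulrn_ge0 //.
  by rewrite -[y]mulr1n lg_disjMn.
have := xP n.+1 isT y yp; rewrite (lg_abs_id y0) lg_glbC lg_glb_id // => <-.
exact: lg_leUl.
Qed.

End TruncAxiom4.

Section TruncTheory.
Variable A : truncType.
Implicit Types x y z a b c : A.

Lemma trunc_le a : 0 <= a -> trunc a <= a.
Proof. by move=> a0; have [] := truncT1 a a a0 a0. Qed.

Lemma trunc_mono a b : 0 <= a -> a <= b -> trunc a <= trunc b.
Proof.
move=> a0 ab; have b0 := le_trans a0 ab.
have [+ _] := truncT1 b a b0 a0; apply: le_trans.
by rewrite lexglb lexx andbT (le_trans _ ab) // trunc_le.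
Qed.

Lemma trunc_subr_mono a b : 0 <= a -> a <= b -> a - trunc a <= b - trunc b.
Proof.
move=> a0 ab; have b0 := le_trans a0 ab.
apply: (@le_trans _ _ (lg_pos (a - trunc b))).
  by rewrite -lg_subI lg_le2l lg_leN; have [] := truncT1 a b a0 b0.
by rewrite lg_posP ?lg_subr_ge0 ?trunc_le // lg_le2r.
Qed.

Lemma trunc_archimedean a x :
  0 <= a -> 0 <= x -> (forall n, x *+ n <= a) -> x = 0.
Proof.
move=> a0 x0 xa; suff : [set 0 : A] x by [].
rewrite -(truncT4 a a0) => n n0 y yp.
have [b e] := lg_divisible n a n0.
have b0 : 0 <= b by apply: (@lg_pMn_ge0 _ _ n) => //; rewrite e.
have Y0 := lg_abs_ge0 y; rewrite (lg_abs_id x0).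
set z := x \glb lg_abs y.
have z0 : 0 <= z by rewrite lexglb x0.
apply: truncT3 => // k k0; apply/eqP; rewrite -subr_eq0; apply/eqP.
have zb : z *+ k <= b.
  rewrite -(lg_pMn2r _ _ n0) e -mulrnA (le_trans _ (xa (k * n)%N)) //.
  by rewrite lg_lerMn2r // lg_leIl.
have zk0 := lg_mulrn_ge0 k z0.
have t0 : 0 <= z *+ k - trunc (z *+ k) by rewrite lg_subr_ge0 trunc_le.
have bt0 : 0 <= b - trunc b by rewrite lg_subr_ge0 trunc_le.
apply/le_anti; rewrite t0 andbT.
have := yp _ erefl; rewrite (ominus_ofE _ n0 e).
rewrite [lg_abs (_ *+ n)]lg_abs_id ?lg_mulrn_ge0 // => yb.
have yb1 : (b - trunc b) \glb lg_abs y = 0.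
  apply/le_anti; rewrite lexglb bt0 Y0 !andbT -yb lexglb lg_leIr.
  by rewrite (le_trans (lg_leIl _ _)) // lg_lerMn.
rewrite -(lg_disjMn 1 k bt0 Y0 yb1) mulr1n lexglb trunc_subr_mono //=.
rewrite (@le_trans _ _ (z *+ k)) ?lg_lerBl ?lg_ler_wpDr ?trunc_ge0 //.
by rewrite lg_lerMn2r // lg_leIr.
Qed.

Lemma trunc_lip a b : 0 <= a -> 0 <= b ->
  lg_abs (trunc a - trunc b) <= lg_abs (a - b).
Proof.
have half c d : 0 <= c -> 0 <= d -> trunc c - trunc d <= lg_abs (c - d).
  move=> c0 d0; set e := lg_abs _.
  have de : 0 <= d + e by rewrite lg_addr_ge0 // lg_abs_ge0.
  have cde : c <= d + e by rewrite addrC -lg_lerBl lg_le_abs.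
  rewrite lg_lerBl (le_trans (trunc_mono c0 cde)) //.
  have dde : d <= d + e by rewrite lg_ler_wpDr // lg_abs_ge0.
  have := trunc_subr_mono d0 dde.
  by rewrite lg_lerBr addrAC lg_lerBl -addrA lg_le2l.
move=> a0 b0; rewrite lg_absP half //= opprB -lg_absN opprB.
exact: half.
Qed.

End TruncTheory.

(* An intrinsic characterization of truncation kernels (truncation_kernelP),
   used to show that they form a frame. *)
Record kernel_axioms (A : truncType) (K : set A) : Prop := {
  kaxB : forall x y, K x -> K y -> K (x - y);
  kax0 : K 0;
  kax_conv : forall x y, K x -> lg_abs y <= lg_abs x -> K y;
  kaxT2 : forall a, 0 <= a -> K (trunc a) -> K a;
  kaxT3 : forall a, 0 <= a ->
    (forall n, (0 < n)%N -> K (a *+ n - trunc (a *+ n))) -> K a;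
  kaxT4 : forall a x, 0 <= a -> 0 <= x ->
    (forall n, K (lg_pos (x *+ n - a))) -> K x
}.

Section KernelOfMorphism.
Variables (A B : truncType) (f : A -> B).
Hypothesis fm : truncation_morphism f.

Lemma tmor0 : f 0 = 0.
Proof. by apply: (addrI (f 0)); rewrite -(tmorD fm) !addr0. Qed.

Lemma tmorN : {morph f : x / - x}.
Proof.
by move=> x; apply: (addrI (f x)); rewrite -(tmorD fm) !subrr tmor0.
Qed.

Lemma tmorMn n : {morph f : x / x *+ n}.
Proof.
move=> x; elim: n => [|n IH]; first by rewrite !mulr0n tmor0.
by rewrite !mulrS (tmorD fm) IH.
Qed.

Lemma tmor_abs x : f (lg_abs x) = lg_abs (f x).
Proof. by rewrite /lg_abs (tmorU fm) tmorN. Qed.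

Lemma tmor_le x y : x <= y -> f x <= f y.
Proof. by move=> xy; rewrite -(lg_glb_id xy) (tmorI fm) lg_leIr. Qed.

Lemma tmor_ge0 x : 0 <= x -> 0 <= f x.
Proof. by move/tmor_le; rewrite tmor0. Qed.

Lemma kernel_axioms_morphism : kernel_axioms [set a | f a = 0].
Proof.
split=> /=.
- by move=> x y fx fy; rewrite (tmorD fm) tmorN fx fy subrr.
- exact: tmor0.
- move=> x y fx /tmor_le; rewrite !tmor_abs fx lg_abs0 => le0.
  by apply/lg_abs0_eq0/le_anti; rewrite le0 lg_abs_ge0.
- by move=> a a0; rewrite (tmorT fm) // => /truncT2 ->//; exact: tmor_ge0.
- move=> a a0 h; apply: truncT3 => [|n n0]; first exact: tmor_ge0.
  have := h n n0; rewrite (tmorD fm) tmorN (tmorT fm) ?lg_mulrn_ge0 //.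
  by rewrite tmorMn => /eqP; rewrite subr_eq0 => /eqP.
- move=> a x a0 x0 h; apply: (trunc_archimedean (tmor_ge0 a0) (tmor_ge0 x0)).
  move=> n; have := h n; rewrite (tmorU fm) (tmorD fm) tmorN tmorMn tmor0.
  by move=> e; rewrite -lg_subr_ge0 -lg_oppr_le0 opprB -e lg_leUl.
Qed.

End KernelOfMorphism.

Section Quotient.
Variables (A : truncType) (K : set A).
Hypothesis HK : kernel_axioms K.
Implicit Types x y z a b : A.

Let K0 : K 0. Proof. exact: (kax0 HK). Qed.
Let KB x y : K x -> K y -> K (x - y). Proof. exact: (kaxB HK). Qed.
Let KN x : K x -> K (- x). Proof. by rewrite -[- x]sub0r; apply: KB. Qed.
Let KD x y : K x -> K y -> K (x + y).
Proof. by move=> Kx Ky; rewrite -[y]opprK; apply: KB => //; exact: KN. Qed.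
Let Kle x y : 0 <= x -> x <= y -> K y -> K x.
Proof. by move=> x0 xy /(kax_conv HK); apply; exact: lg_abs_mono. Qed.
Let Kabs x : K x -> K (lg_abs x).
Proof. by move=> /(kax_conv HK); apply; rewrite lg_abs_id // lg_abs_ge0. Qed.

Definition kpred : {pred A} := fun x => `[< K x >].

Fact kpred_zmod : zmod_closed kpred.
Proof.
split=> [|x y]; rewrite !unfold_in; first by apply/asboolP.
by move=> /asboolP Kx /asboolP Ky; apply/asboolP; exact: KB.
Qed.

HB.instance Definition _ := GRing.isZmodClosed.Build A kpred kpred_zmod.

Definition quo := Quotient.quot kpred.
HB.instance Definition _ := GRing.Zmodule.on quo.
HB.instance Definition _ := EqQuotient.on quo.

Definition kpi (x : A) : quo := (\pi_quo x)%qT.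

Lemma kpiP x y : kpi x = kpi y <-> K (x - y).
Proof.
have := Quotient.idealrBE kpred x y; rewrite unfold_in /= => e.
split=> [/eqP|Kxy]; first by rewrite -e => /asboolP.
by apply/eqP; rewrite -e; apply/asboolP.
Qed.

Lemma kpiD x y : kpi (x + y) = kpi x + kpi y.
Proof. by rewrite /kpi !piE. Qed.

Lemma kpi0 : kpi 0 = 0. Proof. by rewrite /kpi !piE. Qed.

Lemma kpi_eq0 x : kpi x = 0 <-> K x.
Proof. by rewrite -kpi0 kpiP subr0. Qed.

Lemma kpiMn x n : kpi (x *+ n) = kpi x *+ n.
Proof.
by elim: n => [|n IH]; rewrite ?mulr0n ?kpi0 // !mulrS kpiD IH.
Qed.

Lemma krepr (p : quo) : kpi (repr p) = p.
Proof. exact: reprK. Qed.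

Definition quo_le (p q : quo) : bool := `[< K (lg_pos (repr p - repr q)) >].

Lemma quo_leP x y : quo_le (kpi x) (kpi y) <-> K (lg_pos (x - y)).
Proof.
have main x1 y1 x2 y2 : K (x1 - x2) -> K (y1 - y2) ->
    K (lg_pos (x1 - y1)) -> K (lg_pos (x2 - y2)).
  move=> /Kabs Kx /Kabs Ky Kp; apply: (Kle (lg_pos_ge0 _)); last first.
    exact: (KD Kp (KD Kx Ky)).
  rewrite lg_posP; last first.
    by rewrite lg_addr_ge0 ?lg_pos_ge0 // lg_addr_ge0 // lg_abs_ge0.
  have -> : x2 - y2 = (x1 - y1) + (- (x1 - x2) + (y1 - y2)).
    by rewrite opprB [RHS]addrC -[RHS]addrA [y1 - y2 + _]addrC !subrKA.
  by rewrite !lg_leD // ?lg_leUl ?lg_leUr.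
have Kr z : K (repr (kpi z) - z) by apply/kpiP; rewrite krepr.
have Kr' z : K (z - repr (kpi z)) by apply/kpiP; rewrite krepr.
split=> [/asboolP|] h; first exact: (main _ _ _ _ (Kr x) (Kr y) h).
by apply/asboolP; exact: (main _ _ _ _ (Kr' x) (Kr' y) h).
Qed.

Fact quo_le_refl : reflexive quo_le.
Proof. by move=> p; rewrite -(krepr p); apply/quo_leP; rewrite subrr lg_pos_id. Qed.

Fact quo_le_anti : antisymmetric quo_le.
Proof.
move=> p q; rewrite -(krepr p) -(krepr q) => /andP[/quo_leP h1 /quo_leP h2].
by apply/kpiP; rewrite [_ - _]lg_posE opprB; exact: KB.
Qed.

Fact quo_le_trans : transitive quo_le.
Proof.
move=> q p r; rewrite -(krepr p) -(krepr q) -(krepr r).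
move=> /quo_leP h1 /quo_leP h2; apply/quo_leP.
apply: (Kle _ _ (KD h1 h2)); first exact: lg_pos_ge0.
rewrite lg_posP ?lg_addr_ge0 ?lg_pos_ge0 //.
by rewrite -(subrKA (repr q)) lg_leD // lg_leUl.
Qed.

HB.instance Definition _ := Order.Le_isPOrder.Build ring_display quo
  quo_le_refl quo_le_anti quo_le_trans.

Lemma kpi_leP x y : kpi x <= kpi y <-> K (lg_pos (x - y)).
Proof. exact: quo_leP. Qed.

Lemma kpi_le x y : x <= y -> kpi x <= kpi y.
Proof.
move=> xy; apply/kpi_leP; suff -> : lg_pos (x - y) = 0 by [].
by apply/le_anti; rewrite lg_pos_ge0 andbT lg_posP // lg_lerBl add0r.
Qed.

Lemma kpi_lexI w x y :
  (kpi w <= kpi (x \glb y)) = (kpi w <= kpi x) && (kpi w <= kpi y).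
Proof.
apply/idP/andP => [h|[/kpi_leP h1 /kpi_leP h2]].
  by split; rewrite (le_trans h) // kpi_le // ?lg_leIl ?lg_leIr.
apply/kpi_leP; apply: (Kle _ _ (KD h1 h2)); first exact: lg_pos_ge0.
rewrite lg_posP ?lg_addr_ge0 ?lg_pos_ge0 // lg_oppI addrC lg_addUr.
by rewrite ![- _ + w]addrC lublex lg_le_posDl lg_le_posDr.
Qed.

Lemma kpi_leUx w x y :
  (kpi (x \lub y) <= kpi w) = (kpi x <= kpi w) && (kpi y <= kpi w).
Proof.
apply/idP/andP => [h|[/kpi_leP h1 /kpi_leP h2]].
  by split; rewrite (le_trans _ h) // kpi_le // ?lg_leUl ?lg_leUr.
apply/kpi_leP; apply: (Kle _ _ (KD h1 h2)); first exact: lg_pos_ge0.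
rewrite lg_posP ?lg_addr_ge0 ?lg_pos_ge0 // lg_addUr.
by rewrite lublex lg_le_posDl lg_le_posDr.
Qed.

Fact quo_lexI (p q r : quo) :
  (p <= kpi (repr q \glb repr r)) = (p <= q) && (p <= r).
Proof. by rewrite -{1}(krepr p) kpi_lexI !krepr. Qed.

Fact quo_leUx (p q r : quo) :
  (kpi (repr p \lub repr q) <= r) = (p <= r) && (q <= r).
Proof. by rewrite -{1}(krepr r) kpi_leUx !krepr. Qed.

Fact quo_leD2r (p q r : quo) : p <= q -> p + r <= q + r.
Proof.
rewrite -(krepr p) -(krepr q) -(krepr r) => /kpi_leP h.
by rewrite -!kpiD; apply/kpi_leP; rewrite opprD addrACA subrr addr0.
Qed.

Fact quo_divisible n (p : quo) : (0 < n)%N -> exists q : quo, q *+ n = p.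
Proof.
move=> n0; have [y e] := lg_divisible n (repr p) n0.
by exists (kpi y); rewrite -kpiMn e krepr.
Qed.

HB.instance Definition _ := POrderedZmodule_isDivisibleLGroup.Build quo
  quo_lexI quo_leUx quo_leD2r quo_divisible.

Lemma kpiI x y : kpi (x \glb y) = kpi x \glb kpi y.
Proof.
have h p : (p <= kpi (x \glb y)) = (p <= kpi x \glb kpi y).
  by rewrite -(krepr p) kpi_lexI lexglb.
by apply/le_anti/andP; split; [rewrite -h|rewrite h].
Qed.

Lemma kpiU x y : kpi (x \lub y) = kpi x \lub kpi y.
Proof.
have h p : (kpi (x \lub y) <= p) = (kpi x \lub kpi y <= p).
  by rewrite -(krepr p) kpi_leUx lublex.
by apply/le_anti/andP; split; [rewrite h|rewrite -h].
Qed.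

Definition quo_trunc (p : quo) : quo := kpi (trunc (lg_pos (repr p))).

Lemma kpi_pos x : 0 <= kpi x -> kpi (lg_pos x) = kpi x.
Proof.
rewrite -kpi0 => /kpi_leP; rewrite sub0r => h; apply/kpiP.
by rewrite {2}[x]lg_posE opprB addrC subrK.
Qed.

Lemma kpiT a : 0 <= a -> quo_trunc (kpi a) = kpi (trunc a).
Proof.
move=> a0; apply/kpiP; set r := repr _.
have : K (lg_pos r - a).
  by apply/kpiP; rewrite kpi_pos krepr // -kpi0 kpi_le.
by move=> h; apply: (kax_conv HK h); rewrite trunc_lip // lg_pos_ge0.
Qed.

Lemma quo_posP (p : quo) : 0 <= p -> exists2 a, 0 <= a & p = kpi a.
Proof.
move=> p0; exists (lg_pos (repr p)); first exact: lg_pos_ge0.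
by rewrite kpi_pos krepr.
Qed.

Fact quo_trunc_ge0 p : 0 <= p -> 0 <= quo_trunc p.
Proof.
by move=> /quo_posP[a a0 ->]; rewrite kpiT // -kpi0 kpi_le // trunc_ge0.
Qed.

Fact quo_truncT1 p q : 0 <= p -> 0 <= q ->
  p \glb quo_trunc q <= quo_trunc p /\ quo_trunc p <= p.
Proof.
move=> /quo_posP[a a0 ->] /quo_posP[b b0 ->].
by rewrite !kpiT // -kpiI; have [] := truncT1 a b a0 b0; split; exact: kpi_le.
Qed.

Fact quo_truncT2 p : 0 <= p -> quo_trunc p = 0 -> p = 0.
Proof.
move=> /quo_posP[a a0 ->]; rewrite kpiT // => /kpi_eq0 h.
by apply/kpi_eq0; exact: (kaxT2 HK).
Qed.

Fact quo_truncT3 p : 0 <= p ->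
  (forall n, (0 < n)%N -> p *+ n = quo_trunc (p *+ n)) -> p = 0.
Proof.
move=> /quo_posP[a a0 ->] h; apply/kpi_eq0/(kaxT3 HK) => // n n0.
by apply/kpiP; rewrite kpiMn h // -kpiMn kpiT // lg_mulrn_ge0.
Qed.

Fact quo_truncT4 p : 0 <= p ->
  \bigcap_(n in [set n : nat | (0 < n)%N])
    polar (polar [set ominus_of quo_trunc p n%:R]) = [set 0].
Proof.
move=> p0; apply: trunc_polars0 => //.
- exact: quo_trunc_ge0.
- exact: quo_truncT1.
- exact: quo_truncT2.
move=> _ /quo_posP[x x0 ->]; have [a a0 ->] := quo_posP p0 => h.
apply/kpi_eq0/(kaxT4 HK a0 x0) => n; apply/kpi_leP.
by rewrite kpiMn.
Qed.

HB.instance Definition _ := DivisibleLGroup_isTrunc.Build quo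
  quo_trunc_ge0 quo_truncT1 quo_truncT2 quo_truncT3 quo_truncT4.

Lemma kernel_axioms_kernel : truncation_kernel K.
Proof.
exists quo, kpi; split; last first.
  by apply/seteqP; split=> x /kpi_eq0.
split; [exact: kpiD|exact: kpiI|exact: kpiU|].
by move=> a a0; rewrite -kpiT.
Qed.

End Quotient.

Lemma truncation_kernelP (A : truncType) (K : set A) :
  truncation_kernel K <-> kernel_axioms K.
Proof.
split=> [[B [f [fm ->]]]|]; first exact: kernel_axioms_morphism.
exact: kernel_axioms_kernel.
Qed.

HB.mixin Record TBLattice_isFrame d L of Order.TBLattice d L := {
  fsup : set L -> L;
  fsup_ub : forall S x, S x -> x <= fsup S;
  fsup_least : forall S y, (forall x, S x -> x <= y) -> fsup S <= y;
  fmeet_sup : forall x S, x `&` fsup S = fsup [set x `&` y | y in S]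
}.

#[short(type="frameType")]
HB.structure Definition Frame d :=
  { L of TBLattice_isFrame d L & Order.TBLattice d L }.

Record frame_map d d' (L : frameType d) (M : frameType d') (f : L -> M) : Prop := {
  fmap_top : f \top = \top;
  fmap_meet : {morph f : x y / x `&` y};
  fmap_sup : forall S, f (fsup S) = fsup (f @` S)
}.

Definition rather_below d (L : frameType d) (x y : L) : Prop :=
  exists z, x `&` z = \bot /\ z `|` y = \top.

Definition completely_below d (L : frameType d) (x y : L) : Prop :=
  exists c : rat -> L, [/\ c 0 = x, c 1 = y &
    forall p q, (0 <= p)%R -> (p < q)%R -> (q <= 1)%R -> rather_below (c p) (c q)].

Definition completely_regular d (L : frameType d) : Prop :=
  forall y : L, y = fsup [set x | completely_below x y].

Definition bool_sup (S : set bool) : bool := `[< S true >].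

Lemma bool_supT S : S true -> bool_sup S = true.
Proof. by move=> St; apply/asboolP. Qed.

Fact bool_sup_ub S x : S x -> x <= bool_sup S.
Proof. by case: x => [/bool_supT ->|_]; [exact: lexx|exact: le0x]. Qed.

Fact bool_sup_least S (y : bool) : (forall x, S x -> x <= y) -> bool_sup S <= y.
Proof.
rewrite /bool_sup; case: asboolP => [St|_ _]; last exact: le0x.
by move/(_ _ St).
Qed.

Fact bool_meet_sup (x : bool) S :
  x `&` bool_sup S = bool_sup [set x `&` y | y in S].
Proof.
apply/le_anti/andP; split.
  case: x; last exact: le0x.
  rewrite (le_trans (leIr _ _)) //; apply: bool_sup_least => y Sy.
  by apply: bool_sup_ub; exists y => //; rewrite meet1x.
apply: bool_sup_least => _ [y Sy <-].
by rewrite lexI leIl (le_trans (leIr _ _)) // bool_sup_ub.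
Qed.

HB.instance Definition _ := TBLattice_isFrame.Build _ bool
  bool_sup_ub bool_sup_least bool_meet_sup.

HB.mixin Record Frame_isPointed d L of Frame d L := {
  pt : L -> bool;
  pt_frame_map : frame_map pt
}.

#[short(type="pframeType")]
HB.structure Definition PFrame d := { L of Frame_isPointed d L & Frame d L }.

Record pframe_map d d' (L : pframeType d) (M : pframeType d') : Type := PFrameMap {
  pframe_fun :> L -> M;
  pframe_frame_map : frame_map pframe_fun;
  pframe_pt : forall x, pt (pframe_fun x) = pt x
}.

Record opens (T : topologicalType) := Opens {
  opens_set :> set T;
  opens_open : open opens_set
}.

Section Opens.
Variable T : topologicalType.
Implicit Types U V W : opens T.

Lemma opens_inj U V : (U : set T) = V -> U = V.
Proof.
case: U V => [U oU] [V oV] /= e; subst V; congr Opens; exact: Prop_irrelevance.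
Qed.

HB.instance Definition _ := gen_eqMixin (opens T).
HB.instance Definition _ := gen_choiceMixin (opens T).

Definition opens_le U V : bool := `[< (U : set T) `<=` V >].

Fact opens_le_refl : reflexive opens_le.
Proof. by move=> U; apply/asboolP. Qed.
Fact opens_le_anti : antisymmetric opens_le.
Proof.
by move=> U V /andP[/asboolP h1 /asboolP h2]; apply: opens_inj; apply/seteqP.
Qed.
Fact opens_le_trans : transitive opens_le.
Proof.
move=> V U W /asboolP h1 /asboolP h2; apply/asboolP; exact: subset_trans h2.
Qed.

HB.instance Definition _ := Order.Le_isPOrder.Build (Order.Disp tt tt) (opens T)
  opens_le_refl opens_le_anti opens_le_trans.

Lemma opens_leP U V : U <= V <-> (U : set T) `<=` V.
Proof. by split=> [/asboolP|?]; last exact/asboolP. Qed.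

Definition opensI U V := Opens (openI (opens_open U) (opens_open V)).
Definition opensU U V := Opens (openU (opens_open U) (opens_open V)).
Definition opens_sup (S : set (opens T)) : opens T :=
  Opens (bigcup_open (fun U (_ : S U) => opens_open U)).

Fact opens_lexI U V W : (U <= opensI V W) = (U <= V) && (U <= W).
Proof.
apply/idP/andP => [/opens_leP|[/opens_leP h1 /opens_leP h2]].
  by rewrite subsetI => -[? ?]; split; apply/opens_leP.
by apply/opens_leP; rewrite subsetI.
Qed.

Fact opens_leUx U V W : (opensU U V <= W) = (U <= W) && (V <= W).
Proof.
apply/idP/andP => [/opens_leP|[/opens_leP h1 /opens_leP h2]].
  by rewrite subUset => -[? ?]; split; apply/opens_leP.
by apply/opens_leP; rewrite subUset.
Qed.

HB.instance Definition _ := Order.POrder_MeetJoin_isLattice.Build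
  (Order.Disp tt tt) (opens T) opens_lexI opens_leUx.

Fact opens_le0x U : Opens open0 <= U. Proof. by apply/opens_leP => x. Qed.
Fact opens_lex1 U : U <= Opens openT. Proof. by apply/opens_leP => x. Qed.

HB.instance Definition _ := Order.hasBottom.Build (Order.Disp tt tt) (opens T)
  opens_le0x.
HB.instance Definition _ := Order.hasTop.Build (Order.Disp tt tt) (opens T)
  opens_lex1.

Fact opens_sup_ub S U : S U -> U <= opens_sup S.
Proof. by move=> SU; apply/opens_leP => x Ux; exists U. Qed.

Fact opens_sup_least S V : (forall U, S U -> U <= V) -> opens_sup S <= V.
Proof. by move=> h; apply/opens_leP => x [U /h/opens_leP]; apply. Qed.

Fact opens_meet_sup U S : U `&` opens_sup S = opens_sup [set U `&` V | V in S].
Proof.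
apply: opens_inj; apply/seteqP; split=> x.
  by move=> [Ux [V SV Vx]]; exists (U `&` V); [exists V|].
by move=> [_ [V SV <-] [Ux Vx]]; split=> //; exists V.
Qed.

HB.instance Definition _ := TBLattice_isFrame.Build (Order.Disp tt tt) (opens T)
  opens_sup_ub opens_sup_least opens_meet_sup.

End Opens.

Section KernelAxiomsTheory.
Variable A : truncType.

Lemma kernel_axioms_bigcap (P : set (set A)) :
  (forall K, P K -> kernel_axioms K) -> kernel_axioms (\bigcap_(K in P) K).
Proof.
move=> PK; split.
- by move=> x y Kx Ky K KP; apply: (kaxB (PK _ KP)); [exact: Kx|exact: Ky].
- by move=> K KP; exact: (kax0 (PK _ KP)).
- by move=> x y Kx yx K KP; apply: (kax_conv (PK _ KP)) yx; exact: Kx.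
- by move=> a a0 Ka K KP; apply: (kaxT2 (PK _ KP)) => //; exact: Ka.
- by move=> a a0 Ka K KP; apply: (kaxT3 (PK _ KP)) => // n n0; exact: Ka.
- by move=> a x a0 x0 h K KP; apply: (kaxT4 (PK _ KP) a0 x0) => n; exact: h.
Qed.

Lemma kernel_axioms0 : kernel_axioms [set 0 : A].
Proof.
have fm : truncation_morphism (@id A) by split.
exact: (kernel_axioms_morphism fm).
Qed.

Lemma kernel_axiomsT : kernel_axioms [set: A].
Proof. by split. Qed.

Lemma kernel_axioms_residual (J : set A) (B : set A) : kernel_axioms J ->
  kernel_axioms [set x | forall b, B b -> J (lg_abs x \glb lg_abs b)].
Proof.
move=> HJ.
have Jle x y : 0 <= x -> x <= y -> J y -> J x.
  by move=> x0 xy /(kax_conv HJ); apply; exact: lg_abs_mono.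
have JD x y : J x -> J y -> J (x + y).
  move=> Jx Jy; rewrite -[y]opprK; apply: (kaxB HJ) => //.
  by rewrite -[- y]sub0r; apply: (kaxB HJ) => //; exact: (kax0 HJ).
have JMn n x : J x -> J (x *+ n).
  move=> Jx; elim: n => [|n IH]; first by rewrite mulr0n; exact: (kax0 HJ).
  by rewrite mulrS; exact: JD.
have JM n u c : 0 <= u -> 0 <= c -> J (u \glb c) -> J (u \glb (c *+ n)).
  move=> u0 c0 /(JMn n); apply: Jle; last exact: lg_meetMn.
  by rewrite lexglb u0 lg_mulrn_ge0.
have I0 x y : 0 <= lg_abs x \glb lg_abs y by rewrite lexglb !lg_abs_ge0.
split=> /=.
- move=> x y Jx Jy b Bb; apply: Jle (JD _ _ (Jx b Bb) (Jy b Bb)); first exact: I0.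
  rewrite !(lg_glbC _ (lg_abs b)).
  rewrite (le_trans _ (lg_meetDl _ _ _)) ?lg_abs_ge0 //.
  by rewrite lexglb lg_leIl (le_trans (lg_leIr _ _)) // lg_absB.
- by move=> b Bb; rewrite lg_abs0 lg_glb_id ?lg_abs_ge0 //; exact: kax0.
- move=> x y Jx yx b Bb; apply: Jle (Jx b Bb); first exact: I0.
  by rewrite lexglb lg_leIr andbT (le_trans (lg_leIl _ _)).
- move=> a a0 Ja b Bb; rewrite lg_abs_id //; set c := lg_abs b.
  have c0 : 0 <= c := lg_abs_ge0 b.
  have z0 : 0 <= a \glb c by rewrite lexglb a0.
  apply: (kaxT2 HJ) => //; apply: Jle (Ja b Bb); first exact: trunc_ge0.
  rewrite (lg_abs_id (trunc_ge0 a a0)) lexglb trunc_mono ?lg_leIl //=.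
  by rewrite (le_trans (trunc_le z0)) // lg_leIr.
- move=> a a0 Ja b Bb; rewrite lg_abs_id //; set c := lg_abs b.
  have c0 : 0 <= c := lg_abs_ge0 b.
  have z0 : 0 <= a \glb c by rewrite lexglb a0.
  apply: (kaxT3 HJ) => // n n0.
  have zn0 := lg_mulrn_ge0 n z0; have an0 := lg_mulrn_ge0 n a0.
  have u0 : 0 <= a *+ n - trunc (a *+ n) by rewrite lg_subr_ge0 trunc_le.
  have := Ja n n0 b Bb; rewrite (lg_abs_id u0) -/c => /(JM n _ _ u0 c0).
  apply: Jle; first by rewrite lg_subr_ge0 trunc_le.
  rewrite lexglb trunc_subr_mono ?lg_lerMn2r ?lg_leIl //=.
  rewrite lg_lerBl (@le_trans _ _ (c *+ n)) ?lg_lerMn2r ?lg_leIr //.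
  by rewrite lg_ler_wpDr // trunc_ge0.
- move=> a x a0 x0 Jx b Bb; rewrite lg_abs_id //; set c := lg_abs b.
  have c0 : 0 <= c := lg_abs_ge0 b.
  have z0 : 0 <= x \glb c by rewrite lexglb x0.
  apply: (kaxT4 HJ a0) => // n; have p0 := lg_pos_ge0 (x *+ n - a).
  have := Jx n b Bb; rewrite (lg_abs_id p0) -/c => /(JM n _ _ p0 c0).
  apply: Jle; first exact: lg_pos_ge0.
  rewrite lexglb lg_pos_mono ?lg_le2r ?lg_lerMn2r ?lg_leIl //=.
  rewrite lg_posP ?lg_mulrn_ge0 // lg_lerBl.
  rewrite (@le_trans _ _ (c *+ n)) ?lg_lerMn2r ?lg_leIr //.
  exact: lg_ler_wpDr.
Qed.

End KernelAxiomsTheory.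

Record tkernel (A : truncType) := TKernel {
  tkernel_set :> set A;
  tkernelP : truncation_kernel tkernel_set
}.

Section TKernels.
Variable A : truncType.
Implicit Types (K J : tkernel A) (B : set A).

Lemma tkernel_inj K J : (K : set A) = J -> K = J.
Proof.
case: K J => [K kK] [J kJ] /= e; subst J; congr TKernel; exact: Prop_irrelevance.
Qed.

Lemma tkernel_axioms K : kernel_axioms K.
Proof. exact/truncation_kernelP/tkernelP. Qed.

HB.instance Definition _ := gen_eqMixin (tkernel A).
HB.instance Definition _ := gen_choiceMixin (tkernel A).

Definition tkernel_le K J : bool := `[< (K : set A) `<=` J >].

Fact tkernel_le_refl : reflexive tkernel_le.
Proof. by move=> K; apply/asboolP. Qed.
Fact tkernel_le_anti : antisymmetric tkernel_le.
Proof.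
by move=> K J /andP[/asboolP h1 /asboolP h2]; apply: tkernel_inj; apply/seteqP.
Qed.
Fact tkernel_le_trans : transitive tkernel_le.
Proof.
move=> J K I /asboolP h1 /asboolP h2; apply/asboolP; exact: subset_trans h2.
Qed.

HB.instance Definition _ := Order.Le_isPOrder.Build (Order.Disp tt tt) (tkernel A)
  tkernel_le_refl tkernel_le_anti tkernel_le_trans.

Lemma tkernel_leP K J : K <= J <-> (K : set A) `<=` J.
Proof. by split=> [/asboolP|?]; last exact/asboolP. Qed.

Fact gen_subproof B :
  truncation_kernel (\bigcap_(K in [set K | truncation_kernel K /\ B `<=` K]) K).
Proof.
apply/truncation_kernelP/kernel_axioms_bigcap.
by move=> K [/truncation_kernelP].
Qed.

(* The smallest truncation kernel containing B. *)
Definition gen B : tkernel A := TKernel (gen_subproof B).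

Lemma sub_gen B : B `<=` gen B.
Proof. by move=> x Bx K [_]; apply. Qed.

Lemma gen_least B K : B `<=` K -> gen B <= K.
Proof. by move=> BK; apply/tkernel_leP => x; apply; split=> //; exact: tkernelP. Qed.

Fact tkernelI_subproof K J : truncation_kernel ((K : set A) `&` J)%classic.
Proof.
have -> : ((K : set A) `&` J)%classic =
    \bigcap_(I in [set I | I = K :> set A \/ I = J :> set A]) I.
  apply/seteqP; split=> x.
    by move=> [Kx Jx] I /= H; case: H => ->.
  by move=> IP; split; apply: IP; [left|right].
apply/truncation_kernelP/kernel_axioms_bigcap => I [] ->; exact: tkernel_axioms.
Qed.

Definition tkernelI K J : tkernel A := TKernel (tkernelI_subproof K J).
Definition tkernel0 : tkernel A :=
  TKernel ((truncation_kernelP _).2 (kernel_axioms0 A)).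
Definition tkernelT : tkernel A :=
  TKernel ((truncation_kernelP _).2 (kernel_axiomsT A)).
Definition tkernel_sup (S : set (tkernel A)) : tkernel A :=
  gen (\bigcup_(K in S) (K : set A)).
Definition tkernelU K J : tkernel A := gen ((K : set A) `|` J)%classic.

Fact tkernel_lexI K J I : (K <= tkernelI J I) = (K <= J) && (K <= I).
Proof.
apply/idP/andP => [/tkernel_leP|[/tkernel_leP h1 /tkernel_leP h2]].
  by rewrite subsetI => -[? ?]; split; apply/tkernel_leP.
by apply/tkernel_leP; rewrite subsetI.
Qed.

Fact tkernel_leUx K J I : (tkernelU K J <= I) = (K <= I) && (J <= I).
Proof.
apply/idP/andP => [/tkernel_leP h|[/tkernel_leP h1 /tkernel_leP h2]].
  by split; apply/tkernel_leP => x Kx; apply: h; apply: sub_gen; [left|right].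
by apply: gen_least; rewrite subUset.
Qed.

HB.instance Definition _ := Order.POrder_MeetJoin_isLattice.Build
  (Order.Disp tt tt) (tkernel A) tkernel_lexI tkernel_leUx.

Fact tkernel_le0x K : tkernel0 <= K.
Proof. by apply/tkernel_leP => _ ->; exact: (kax0 (tkernel_axioms K)). Qed.
Fact tkernel_lex1 K : K <= tkernelT.
Proof. by apply/tkernel_leP => x. Qed.

HB.instance Definition _ := Order.hasBottom.Build (Order.Disp tt tt) (tkernel A)
  tkernel_le0x.
HB.instance Definition _ := Order.hasTop.Build (Order.Disp tt tt) (tkernel A)
  tkernel_lex1.

Fact tkernel_sup_ub (S : set (tkernel A)) K : S K -> K <= tkernel_sup S.
Proof. by move=> SK; apply/tkernel_leP => x Kx; apply: sub_gen; exists K. Qed.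

Fact tkernel_sup_least (S : set (tkernel A)) J :
  (forall K, S K -> K <= J) -> tkernel_sup S <= J.
Proof. by move=> h; apply: gen_least => x [K /h/tkernel_leP]; apply. Qed.

Fact tkernel_meet_sup K (S : set (tkernel A)) :
  K `&` tkernel_sup S = tkernel_sup [set K `&` J | J in S].
Proof.
apply/le_anti/andP; split; last first.
  apply: tkernel_sup_least => _ [J SJ <-].
  by rewrite lexI leIl (le_trans (leIr _ _)) // tkernel_sup_ub.
set T := tkernel_sup [set K `&` J | J in S].
pose H := TKernel ((truncation_kernelP _).2
  (kernel_axioms_residual (K : set A) (tkernel_axioms T))).
have absP (I : tkernel A) x y : (I : set A) x -> (I : set A) (lg_abs x \glb lg_abs y).
  move=> /(kax_conv (tkernel_axioms I)); apply.
  by rewrite lg_abs_id ?lg_leIl // lexglb !lg_abs_ge0.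
have /tkernel_leP SH : tkernel_sup S <= H.
  apply: tkernel_sup_least => J SJ; apply/tkernel_leP => x Jx b Kb.
  apply: sub_gen; exists (K `&` J); first by exists J.
  by split; [rewrite lg_glbC; exact: absP|exact: absP].
apply/tkernel_leP => x [Kx /SH/(_ x Kx)]; rewrite lg_glb_id //.
by move/(kax_conv (tkernel_axioms T)); apply; rewrite (lg_abs_id (lg_abs_ge0 x)).
Qed.

HB.instance Definition _ := TBLattice_isFrame.Build (Order.Disp tt tt) (tkernel A)
  tkernel_sup_ub tkernel_sup_least tkernel_meet_sup.

Fact polar_subproof B : truncation_kernel (polar B).
Proof.
exact/truncation_kernelP/(kernel_axioms_residual B (kernel_axioms0 A)).
Qed.

Definition polark B : tkernel A := TKernel (polar_subproof B).

(* $a \blacktriangleright r$ *)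
Definition ker_above (a : A) (r : rat) : tkernel A := gen [set ominus a r].

(* $a \blacktriangleleft r$ *)
Definition ker_below (a : A) (r : rat) : tkernel A :=
  fsup [set polark [set ominus a s] | s in [set s : rat | (0 < s < r)%R]].

(* The filter F: the up-closure of the finite meets of the ker_below a 1 for a in
   the range of trunc on A^+. *)
Definition spec_filter (K : tkernel A) : Prop :=
  exists s : seq A, (forall b, b \in s -> 0 <= b) /\
    \meet_(b <- s) ker_below (trunc b) 1 <= K.

Lemma spec_filter_top : spec_filter \top.
Proof. by exists [::]; rewrite lex1. Qed.

Lemma spec_filterS K J : K <= J -> spec_filter K -> spec_filter J.
Proof. by move=> KJ [s [s0 sK]]; exists s; rewrite (le_trans sK). Qed.

Lemma spec_filterI K J : spec_filter K -> spec_filter J -> spec_filter (K `&` J).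
Proof.
move=> [s [s0 sK]] [t [t0 tJ]]; exists (s ++ t); split.
  by move=> b; rewrite mem_cat => /orP[/s0|/t0].
by rewrite big_cat leI2.
Qed.

End TKernels.

(* The subframe 2_F(KA) of 2 x KA; its frame operations are proved below to be
   the componentwise ones. *)
Record spectrum (A : truncType) := Spectrum {
  spec_eps : bool;
  spec_ker : tkernel A;
  spec_cond : spec_eps = \top -> spec_filter spec_ker
}.

Section Spectrum.
Variable A : truncType.
Implicit Types p q r : spectrum A.

Lemma spectrum_inj p q :
  spec_eps p = spec_eps q -> spec_ker p = spec_ker q -> p = q.
Proof.
case: p q => [e K h] [e' K' h'] /= ee KK; subst e' K'.
congr Spectrum; exact: Prop_irrelevance.
Qed.

HB.instance Definition _ := gen_eqMixin (spectrum A).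
HB.instance Definition _ := gen_choiceMixin (spectrum A).

Definition spec_le p q : bool :=
  (spec_eps p <= spec_eps q) && (spec_ker p <= spec_ker q).

Fact spec_le_refl : reflexive spec_le.
Proof. by move=> p; rewrite /spec_le !lexx. Qed.
Fact spec_le_anti : antisymmetric spec_le.
Proof.
move=> p q /andP[/andP[h1 h2] /andP[h3 h4]].
by apply: spectrum_inj; apply/le_anti/andP.
Qed.
Fact spec_le_trans : transitive spec_le.
Proof.
move=> q p r /andP[h1 h2] /andP[h3 h4].
by rewrite /spec_le (le_trans h1) // (le_trans h2).
Qed.

HB.instance Definition _ := Order.Le_isPOrder.Build (Order.Disp tt tt) (spectrum A)
  spec_le_refl spec_le_anti spec_le_trans.

Lemma spec_leE p q :
  (p <= q) = (spec_eps p <= spec_eps q) && (spec_ker p <= spec_ker q).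
Proof. by []. Qed.

Fact specI_subproof p q : spec_eps p `&` spec_eps q = \top ->
  spec_filter (spec_ker p `&` spec_ker q).
Proof.
move=> /eqP; rewrite meet_eq1 => /andP[/eqP ep /eqP eq].
by apply: spec_filterI; exact: spec_cond.
Qed.
Definition specI p q := Spectrum (@specI_subproof p q).

Fact spec_sup_subproof (S : set (spectrum A)) :
  fsup (@spec_eps A @` S) = \top -> spec_filter (fsup (@spec_ker A @` S)).
Proof.
move=> /asboolP[p Sp ep]; apply: spec_filterS (spec_cond ep).
by apply: fsup_ub; exists p.
Qed.
Definition spec_sup S := Spectrum (@spec_sup_subproof S).

Fact specU_subproof p q : spec_eps p `|` spec_eps q = \top ->
  spec_filter (spec_ker p `|` spec_ker q).
Proof.
move=> epq; have /orP[] : (spec_eps p == \top) || (spec_eps q == \top).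
  by move: epq; case: (spec_eps p); case: (spec_eps q).
all: by move=> /eqP/spec_cond; apply: spec_filterS; rewrite ?leUl ?leUr.
Qed.
Definition specU p q := Spectrum (@specU_subproof p q).

Fact spec_bot_subproof (K : tkernel A) : \bot = \top :> bool -> spec_filter K.
Proof. by []. Qed.
Definition spec_bot (K : tkernel A) : spectrum A :=
  Spectrum (spec_bot_subproof K).

Definition spec_top : spectrum A :=
  @Spectrum A \top \top (fun _ => spec_filter_top A).

Fact spec_lexI p q r : (p <= specI q r) = (p <= q) && (p <= r).
Proof. by rewrite !spec_leE /= !lexI andbACA. Qed.

Fact spec_leUx p q r : (specU p q <= r) = (p <= r) && (q <= r).
Proof. by rewrite !spec_leE /= !leUx andbACA. Qed.

HB.instance Definition _ := Order.POrder_MeetJoin_isLattice.Build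
  (Order.Disp tt tt) (spectrum A) spec_lexI spec_leUx.

Fact spec_le0x p : spec_bot \bot <= p.
Proof. by rewrite spec_leE !le0x. Qed.
Fact spec_lex1 p : p <= spec_top.
Proof. by rewrite spec_leE !lex1. Qed.

HB.instance Definition _ := Order.hasBottom.Build (Order.Disp tt tt) (spectrum A)
  spec_le0x.
HB.instance Definition _ := Order.hasTop.Build (Order.Disp tt tt) (spectrum A)
  spec_lex1.

Fact spec_sup_ub (S : set (spectrum A)) p : S p -> p <= spec_sup S.
Proof. by move=> Sp; rewrite spec_leE; apply/andP; split; apply: fsup_ub; exists p. Qed.

Fact spec_sup_least (S : set (spectrum A)) q :
  (forall p, S p -> p <= q) -> spec_sup S <= q.
Proof.
move=> h; rewrite spec_leE; apply/andP; split; apply: fsup_least => _ [p /h + <-];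
  by rewrite spec_leE => /andP[].
Qed.

Fact spec_meet_sup p (S : set (spectrum A)) :
  p `&` spec_sup S = spec_sup [set p `&` q | q in S].
Proof.
by apply: spectrum_inj; rewrite /= fmeet_sup !image_comp.
Qed.

HB.instance Definition _ := TBLattice_isFrame.Build (Order.Disp tt tt) (spectrum A)
  spec_sup_ub spec_sup_least spec_meet_sup.

Fact spec_eps_frame_map : frame_map (@spec_eps A). Proof. by []. Qed.

HB.instance Definition _ := Frame_isPointed.Build (Order.Disp tt tt) (spectrum A)
  spec_eps_frame_map.

End Spectrum.

Section RealMaps.
Variables (R : realType) (d : Order.disp_t) (L : frameType d).
Implicit Types (f g : opens R -> L) (U : opens R).

(* Sum, meet and join of RL are the cases op = +%R, Num.min, Num.max. *)
Definition rmap_op (op : R -> R -> R) f g : opens R -> L := fun U =>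
  fsup [set m | exists U1 U2 : opens R,
    (forall x y, (U1 : set R) x -> (U2 : set R) y -> (U : set R) (op x y)) /\
    m = f U1 `&` g U2].

Fact opensN_subproof U : open [set x : R | (U : set R) (- x)].
Proof.
have /continuousP : continuous (-%R : R -> R) by exact: opp_continuous.
by apply; exact: opens_open.
Qed.
Definition opensN U : opens R := Opens (@opensN_subproof U).

Definition rmap_opp f : opens R -> L := fun U => f (opensN U).

Definition rmap_const (r : R) : opens R -> L := fun U =>
  if `[< (U : set R) r >] then \top else \bot.

End RealMaps.

Record R0 (R : realType) d (L : pframeType d) := R0Map {
  r0_fun :> opens R -> L;
  r0_frame_map : frame_map r0_fun;
  r0_pt : forall U, pt (r0_fun U) = rmap_const bool 0 U
}.

(* A truncation morphism into R_0 L, whose operations are those of RL given by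
   rmap_op, rmap_opp and rmap_const; in particular the truncation of f is f /\ 1. *)
Record R0_truncation_morphism (R : realType) (A : truncType) d (L : pframeType d)
    (theta : A -> R0 R L) : Prop := {
  rmor0 : forall U, theta 0 U = rmap_const L 0 U;
  rmorD : forall a b U, theta (a + b) U = rmap_op +%R (theta a) (theta b) U;
  rmorN : forall a U, theta (- a) U = rmap_opp (theta a) U;
  rmorI : forall a b U,
    theta (a \glb b) U = rmap_op Num.min (theta a) (theta b) U;
  rmorU : forall a b U,
    theta (a \lub b) U = rmap_op Num.max (theta a) (theta b) U;
  rmorT : forall a U, 0 <= a ->
    theta (trunc a) U = rmap_op Num.min (theta a) (rmap_const L 1) U
}.

Section R0map.
Variables (R : realType) (d d' : Order.disp_t).
Variables (M : pframeType d) (L : pframeType d') (g : pframe_map M L) (f : R0 R M).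

Fact R0_map_frame_map : frame_map (g \o f).
Proof.
have [g1 gI gS] := pframe_frame_map g; have [f1 fI fS] := r0_frame_map f.
split=> [|U V|S] /=; first by rewrite f1.
  by rewrite fI gI.
by rewrite fS gS image_comp.
Qed.

Fact R0_map_pt U : pt ((g \o f) U) = rmap_const bool 0 U.
Proof. by rewrite /= pframe_pt r0_pt. Qed.

Definition R0_map : R0 R L := R0Map R0_map_frame_map R0_map_pt.

End R0map.

Definition ray (R : realType) (r : rat) : opens R := Opens (@open_gt R (ratr r)).

(* The defining property of the map a |-> \hat a from A to R_0 MA. *)
Record spectrum_unit (R : realType) (A : truncType)
    (mu : A -> R0 R (spectrum A)) : Prop := {
  unit_morphism : R0_truncation_morphism mu;
  unit_ge0 : forall a r, 0 <= a -> 0 <= r -> mu a (ray R r) = spec_bot (ker_above a r);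
  unit_lt0 : forall a r, 0 <= a -> r < 0 -> mu a (ray R r) = \top
}.

(* Main.v *)
Require Import Defs.
From mathcomp Require Import all_boot all_order all_algebra.
From mathcomp Require Import all_classical all_reals all_analysis.
From mathcomp Require Import lra.

Set Implicit Arguments.
Unset Strict Implicit.
Unset Printing Implicit Defensive.

Import Order.TTheory GRing.Theory Num.Theory.
Import numFieldNormedType.Exports.

Local Open Scope classical_set_scope.
Local Open Scope ring_scope.
Local Open Scope order_scope.

(** Write [P a] for the cozero element [theta a (0, oo)] of a positive [a].

Every pointed frame map [g] with [g (mu a U) = theta a U] is forced to send
[(\bot, [a])], which is [mu a (0, oo)], to [P a].  Since [(\bot, K)] is the join of
the [(\bot, [a])] with [a] in [K], this fixes [g] on the elements with first
coordinate [\bot].  If [K] lies in the filter, say above the meet of the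
[trunc b \blacktriangleleft 1] for [b] in a finite [s], then [(\top, K)] is the
join of [(\bot, K)] and of the meet of the [mu (trunc b) (-oo, 1)]
([spectrum_generation]); the latter meet must go to the meet [theta_below s] of the
[theta (trunc b) (-oo, 1)].  So [g] is unique, and the only candidate is
[spectrum_lift]: the join of all the [P a] and [theta_below s] that lie under
[(\varepsilon, K)] in this sense.

That the candidate preserves joins rests on two facts.  The first is that for every
[w] in the frame the elements [a] with [P |a| <= w] form a truncation kernel
([cozero_kernel]); so [K |-> sup P a] has a right adjoint.  The second is that
[theta_below s] together with finitely many cozero elements covers the whole frame
([theta_below_cover]), so that what [theta_below s] contributes can be tested
cozero element by cozero element.  For that test, and for binary meets, one needs
that [theta a (-oo, 1) /\ P c] lies below the join of the [P x] with [x] in both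
[[c]] and [a \blacktriangleleft 1] ([theta_dn1_meet_le]); the elements
[x = (trunc (n c) - a / r)^+] with rational [r < 1] do it.

Finally the candidate does extend [theta]: for [a >= 0] the two frame maps agree on
the rays [(r, oo)], because [P (a \ominus r) = theta a (r, oo)] ([theta_ominus]),
upper rays determine a frame map on the opens of the line
([frame_map_ext_rays]), and a general [a] is a difference of positive elements.

A frame need not have points, so nothing is checked pointwise in it.  Inequalities
between elements [theta a U] come from the joins that define the operations on
real-valued maps, and from open covers on the line, which become joins in the frame
([frame_map_cover]). *)

(** * Frames and frame maps *)

Section FrameTheory.
Variables (d : Order.disp_t) (L : frameType d).
Implicit Types (x y z w : L) (S T : set L).

Lemma fmeet_fsup_le z w S :
  (forall x, S x -> z `&` x <= w) -> z `&` fsup S <= w.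
Proof.
by move=> h; rewrite fmeet_sup; apply: fsup_least => _ [x Sx <-]; exact: h.
Qed.

Lemma fsup_fmeet_le z w S :
  (forall x, S x -> x `&` z <= w) -> fsup S `&` z <= w.
Proof.
by move=> h; rewrite meetC; apply: fmeet_fsup_le => x Sx; rewrite meetC h.
Qed.

End FrameTheory.

Section FrameMaps.
Variables (d d' : Order.disp_t) (M : frameType d) (L : frameType d') (f : M -> L).
Hypothesis fm : frame_map f.

Lemma frame_map_le x y : x <= y -> f x <= f y.
Proof. by move=> /meet_idPl <-; rewrite (fmap_meet fm) leIr. Qed.

Lemma frame_map_bigmeet (I : Type) (r : seq I) (F : I -> M) :
  f (\meet_(i <- r) F i) = \meet_(i <- r) f (F i).
Proof. by apply: (big_morph f (fmap_meet fm) (fmap_top fm)). Qed.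

End FrameMaps.

(** * Frame maps on the open sets of a space *)

Section OpenSetMaps.
Variables (T : topologicalType) (d : Order.disp_t) (L : frameType d).
Variable f : opens T -> L.
Hypothesis fm : frame_map f.
Implicit Types (U V W : opens T) (z w : L).

(** Points of [T] enter the frame only through this lemma and its consequences
below.  The extra factor [z] makes up for the meet, so that covers coming from
several different maps can be used one after the other. *)
Lemma frame_map_cover z w U (S : set (opens T)) :
  (forall x, (U : set T) x -> exists2 V, S V & (V : set T) x) ->
  (forall V, S V -> z `&` f V <= w) -> z `&` f U <= w.
Proof.
move=> cov h; apply: (@le_trans _ _ (z `&` f (fsup S))).
  apply: leI2 => //; apply: (frame_map_le fm); apply/opens_leP => x /cov[V SV Vx].
  by exists V.
by rewrite (fmap_sup fm); apply: fmeet_fsup_le => _ [V SV <-]; exact: h.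
Qed.

Lemma frame_map_cover2 z w U V :
  (forall x, (U : set T) x \/ (V : set T) x) ->
  z `&` f U <= w -> z `&` f V <= w -> z <= w.
Proof.
move=> cov hU hV; rewrite -[z]meetx1 -(fmap_top fm).
apply: (@frame_map_cover _ _ _ [set U; V]) => [x _|W [] ->//].
by case: (cov x); [exists U|exists V] => //; [left|right].
Qed.

Lemma frame_map_join w U (S : set (opens T)) :
  (forall x, (U : set T) x -> exists2 V, S V & (V : set T) x) ->
  (forall V, S V -> f V <= w) -> f U <= w.
Proof.
move=> cov h; rewrite -[f U]meet1x; apply: (frame_map_cover cov) => V SV.
by rewrite meet1x h.
Qed.

Lemma frame_map_meet_le U V W :
  (forall x, (U : set T) x -> (V : set T) x -> (W : set T) x) ->
  f U `&` f V <= f W.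
Proof.
move=> h; rewrite -(fmap_meet fm); apply: (frame_map_le fm).
by apply/opens_leP => x [Ux Vx]; exact: h.
Qed.

Lemma frame_map_empty w U : (forall x, ~ (U : set T) x) -> f U <= w.
Proof. by move=> h; apply: (@frame_map_join _ _ set0) => [x /h|]. Qed.

Lemma frame_map_disjoint w U V :
  (forall x, (U : set T) x -> (V : set T) x -> False) -> f U `&` f V <= w.
Proof.
move=> h; rewrite -(fmap_meet fm); apply: frame_map_empty => x [Ux Vx].
exact: h Ux Vx.
Qed.

End OpenSetMaps.

(** * Maps determined by their upper rays *)

Section Rays.
Variable R : realType.
Implicit Types (t : R).

Definition up t : opens R := Opens (@open_gt R t).
Definition dn t : opens R := Opens (@open_lt R t).

Lemma opensN_up t : opensN (up t) = dn (- t).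
Proof. by apply: opens_inj; apply/seteqP; split=> x /=; rewrite ltrNr. Qed.

Variables (d : Order.disp_t) (L : frameType d).
Implicit Types f : opens R -> L.

(** Lower rays are recovered from upper ones: for [q < t], the ray [(-oo, q)] is
disjoint from [(q, oo)], and [(q, oo)] covers the line together with [(-oo, t)]. *)
Lemma frame_map_dn_le f f' : frame_map f -> frame_map f' ->
  (forall r : rat, f (ray R r) = f' (ray R r)) -> forall t, f (dn t) <= f' (dn t).
Proof.
move=> fm fm' e t.
apply: (frame_map_join fm (S := [set dn (ratr q) | q in [set q : rat | ratr q < t]])).
  move=> x /= /rat_in_itvoo[q]; rewrite in_itv /= => /andP[xq qt].
  by exists (dn (ratr q)) => //; exists q.
move=> _ [q /= qt <-].
apply: (frame_map_cover2 fm' (U := ray R q) (V := dn t)) => [x /=||].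
- by have [xq|qx] := ltP (ratr q) x; [left|right; exact: le_lt_trans qx qt].
- by rewrite -e; apply: (frame_map_disjoint fm) => x /= /lt_trans h /h; rewrite ltxx.
- exact: leIr.
Qed.

(** By [frame_map_dn_le] the maps agree on lower rays as well, hence on rational
intervals, and these form a base. *)
Lemma frame_map_ext_rays f f' : frame_map f -> frame_map f' ->
  (forall r : rat, f (ray R r) = f' (ray R r)) -> f = f'.
Proof.
have main (g g' : opens R -> L) : frame_map g -> frame_map g' ->
    (forall r : rat, g (ray R r) = g' (ray R r)) -> forall U, g U <= g' U.
  move=> gm gm' e U.
  apply: (frame_map_join gm (S := [set V | V <= U /\
      exists p q : rat, V = ray R p `&` dn (ratr q)])).
    move=> x Ux; have /nbhs_ballP[eps /= eps0 epsU] : nbhs x (U : set R).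
      by apply: open_nbhs_nbhs; split=> //; exact: opens_open.
    have /rat_in_itvoo[p] : x - eps < x by rewrite ltrBlDr ltrDl.
    have /rat_in_itvoo[q] : x < x + eps by rewrite ltrDl.
    rewrite !in_itv /= => /andP[xq qe] /andP[pe px].
    exists (ray R p `&` dn (ratr q)); last by split.
    split; last by exists p, q.
    apply/opens_leP => y [/= py yq]; apply: epsU.
    by rewrite /ball /= distrC ltr_distl; apply/andP; split;
      [exact: lt_trans py|exact: lt_trans yq _].
  move=> V [VU [p [q Ve]]]; subst V; apply: le_trans (frame_map_le gm' VU).
  rewrite (fmap_meet gm) (fmap_meet gm') e.
  by apply: leI2 => //; exact: frame_map_dn_le.
by move=> fm fm' e; apply/funext => U; apply/le_anti; rewrite !main.
Qed.

End Rays.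

(** * Arithmetic of real-valued frame maps *)

Section RealMapOperations.
Variables (R : realType) (d : Order.disp_t) (L : frameType d).
Implicit Types (f g : opens R -> L) (U V W : opens R) (w : L).

Lemma rmap_op_ge op f g U V W :
  (forall x y, (U : set R) x -> (V : set R) y -> (W : set R) (op x y)) ->
  f U `&` g V <= rmap_op op f g W.
Proof. by move=> h; apply: fsup_ub; exists U, V. Qed.

Lemma rmap_op_le op f g W w :
  (forall U V,
    (forall x y, (U : set R) x -> (V : set R) y -> (W : set R) (op x y)) ->
    f U `&` g V <= w) -> rmap_op op f g W <= w.
Proof. by move=> h; apply: fsup_least => _ [U [V [UV ->]]]; exact: h. Qed.

Lemma rmap_const_top (r : R) U : (U : set R) r -> rmap_const L r U = \top.
Proof. by move=> Ur; rewrite /rmap_const asboolT. Qed.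

Lemma rmap_const_bot (r : R) U : ~ (U : set R) r -> rmap_const L r U = \bot.
Proof. by move=> Ur; rewrite /rmap_const asboolF. Qed.

End RealMapOperations.

Lemma frame_map_rmap_op (R : realType) (d d' : Order.disp_t) (M : frameType d)
    (L : frameType d') (h : M -> L) : frame_map h ->
  forall op (f g : opens R -> M) U,
  h (rmap_op op f g U) = rmap_op op (h \o f) (h \o g) U.
Proof.
move=> hm op f g U; rewrite /rmap_op (fmap_sup hm); congr fsup; apply/seteqP; split.
  by move=> _ [_ [V [W [VW ->]]] <-]; exists V, W; split; rewrite ?(fmap_meet hm).
move=> _ [V [W [VW ->]]]; exists (f V `&` g W); last exact: fmap_meet.
by exists V, W.
Qed.

Lemma R0_inj (R : realType) (d : Order.disp_t) (L : pframeType d) (f g : R0 R L) :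
  (forall U, f U = g U) -> f = g.
Proof.
case: f g => [f fm fp] [g gm gp] /= /funext e; subst g.
by congr R0Map; exact: Prop_irrelevance.
Qed.

Section TruncationMorphism.
Variables (R : realType) (A : truncType) (d : Order.disp_t) (L : pframeType d).
Variable theta : A -> R0 R L.
Hypothesis tm : R0_truncation_morphism theta.
Implicit Types (a b c x y : A) (s t : R) (U V : opens R) (z w : L).

Let fm a : frame_map (theta a) := r0_frame_map (theta a).

Lemma theta_opp_up a t : theta (- a) (up t) = theta a (dn (- t)).
Proof. by rewrite (rmorN tm) /rmap_opp opensN_up. Qed.

Lemma theta_up_le a b t : a <= b -> theta a (up t) <= theta b (up t).
Proof.
move=> ab; have <- : a \lub b = b by rewrite lg_lubC lg_lub_id.
rewrite (rmorU tm) -[leLHS]meetx1 -(fmap_top (fm b)); apply: rmap_op_ge => x y /= tx _.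
by rewrite lt_max tx.
Qed.

Lemma theta_up_glb a b t :
  theta a (up t) `&` theta b (up t) <= theta (a \glb b) (up t).
Proof.
by rewrite (rmorI tm); apply: rmap_op_ge => x y /= tx ty; rewrite lt_min tx.
Qed.

Lemma theta_upD_ge a b s t :
  theta a (up s) `&` theta b (up t) <= theta (a + b) (up (s + t)%R).
Proof. by rewrite (rmorD tm); apply: rmap_op_ge => x y /=; exact: ltrD. Qed.

(** If [U + V] is contained in [(s + t, oo)], then [U] is contained in [(s, oo)] or
[V] is contained in [(t, oo)]. *)
Lemma theta_upD_le a b s t w : theta a (up s) <= w -> theta b (up t) <= w ->
  theta (a + b) (up (s + t)%R) <= w.
Proof.
move=> ha hb; rewrite (rmorD tm); apply: rmap_op_le => U V UV.
have [Us|/existsNP[x /not_implyP[Ux /= /negP]]] := EM ((U : set R) `<=` up s).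
  by apply: le_trans (leIl _ _) (le_trans _ ha); apply/(frame_map_le (fm a))/opens_leP.
rewrite -leNgt => xs.
apply: le_trans (leIr _ _) (le_trans _ hb); apply/(frame_map_le (fm b))/opens_leP.
move=> y Vy; have /= := UV _ _ Ux Vy.
by move=> sxy; rewrite -(ltrD2l s) (lt_le_trans sxy) // lerD2r.
Qed.

Lemma theta_upB a b t : theta a (up t) `&` theta b (dn t) <= theta (a - b) (up 0).
Proof.
rewrite -[0%R](subrr t) -[t in dn t]opprK -theta_opp_up; exact: theta_upD_ge.
Qed.

Lemma theta0_up : theta 0 (up 0) = \bot.
Proof. by rewrite (rmor0 tm) rmap_const_bot //= ltxx. Qed.

Lemma theta_up_neg a t : 0 <= a -> t < 0 -> theta a (up t) = \top.
Proof.
move=> a0 t0; apply/le_anti; rewrite lex1 /=.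
by apply: le_trans (theta_up_le t a0); rewrite (rmor0 tm) rmap_const_top.
Qed.

Lemma theta_upMn a n t : theta (a *+ n.+1) (up (t *+ n.+1)%R) = theta a (up t).
Proof.
elim: n => // n IH; rewrite [in LHS]mulrS [(t *+ _)%R]mulrS; apply/le_anti.
rewrite theta_upD_le ?IH //= (le_trans _ (theta_upD_ge _ _ _ _)) // IH.
by rewrite lexI lexx.
Qed.

Lemma theta_dnMn a n t : theta (a *+ n.+1) (dn (t *+ n.+1)%R) = theta a (dn t).
Proof. by rewrite -[t]opprK mulNrn -!theta_opp_up -mulNrn theta_upMn. Qed.

(** Below the level [1] truncation does not change the upper rays. *)
Lemma theta_trunc_up a t : 0 <= a -> t < 1 -> theta a (up t) <= theta (trunc a) (up t).
Proof.
move=> a0 t1; rewrite (rmorT tm) // -[leLHS]meetx1.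
rewrite -(@rmap_const_top R d L 1 (up t)) //.
by apply: rmap_op_ge => x y /= tx ty; rewrite lt_min tx.
Qed.

(** [a - (a /\ 1)] is positive exactly where [a] exceeds [1].  For the inequality
from right to left, [(1, oo)] is exhausted by the [(t, oo)] with [t > 1], and
[trunc a] stays below such a [t] everywhere. *)
Lemma theta_subr_trunc a : 0 <= a -> theta (a - trunc a) (up 0) = theta a (up 1).
Proof.
move=> a0; apply/le_anti/andP; split.
  rewrite (rmorD tm); apply: rmap_op_le => U V UV.
  rewrite (rmorN tm) /rmap_opp (rmorT tm) //; apply: fmeet_fsup_le.
  (* [W] is an open set for [a], [C] one for the constant [1] *)
  move=> _ [W [C [WC ->]]].
  have [C1|C1] := EM ((C : set R) 1); last first.
    by rewrite rmap_const_bot // !meetx0 le0x.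
  rewrite rmap_const_top // meetx1; apply: (frame_map_meet_le (fm a)) => x Ux Wx /=.
  have /(UV _ _ Ux) /= := WC _ _ Wx C1.
  by rewrite subr_gt0 gt_min ltxx.
apply: (frame_map_join (fm a) (S := [set up t | t in [set t : R | 1 < t]])).
  move=> x /= x1; exists (up ((1 + x) / 2)); last by rewrite /=; lra.
  by exists ((1 + x) / 2) => //=; lra.
move=> _ [t /= t1 <-]; apply: le_trans (theta_upB _ _ t).
rewrite (rmorT tm) // lexI lexx /=.
rewrite -[leLHS]meetx1 -(@rmap_const_top R d L 1 (dn t)) //.
by apply: rmap_op_ge => x y _ /= yt; rewrite gt_min yt orbT.
Qed.

End TruncationMorphism.

(** * Rational multiples and excess over a truncation *)

Section RationalMultiples.
Variable A : divLGroupType.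
Implicit Types (x y : A) (r : rat).

Lemma lg_mulrzI (m : int) x y : 0 < m -> x *~ m = y *~ m -> x = y.
Proof. by case: m => // m m0; exact: lg_pMnI. Qed.

Lemma ratmulP r x : ratmul r x *~ denq r = x *~ numq r.
Proof.
have d0 := denq_gt0 r; rewrite /ratmul; case: xgetP => // /(_ _) none.
case: (denq r) d0 none => // q q0 none.
by have [y e] := lg_divisible q (x *~ numq r) q0; case: (none y).
Qed.

Lemma ratmulB r x y : ratmul r (x - y) = ratmul r x - ratmul r y.
Proof. by apply: ratmul_unique; rewrite !mulrzBl !ratmulP. Qed.

Lemma ratmulVK r x : r != 0 -> ratmul r (ratmul r^-1 x) = x.
Proof.
move=> r0; apply: ratmul_unique; apply: (lg_mulrzI (denq_gt0 r^-1)).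
rewrite -!mulrzA [(numq r * _)%R]mulrC [RHS]mulrzA ratmulP -mulrzA.
congr (_ *~ _); apply: (@intr_inj rat); rewrite !rmorphM /= !numqE.
by rewrite mulrACA mulVf // mul1r mulrC.
Qed.

(** Reduces rational multiples to natural ones; the fraction does not depend on
the element multiplied. *)
Lemma ratmul_gt0_frac r : 0 < r -> exists p q : nat,
  r = p.+1%:R / q.+1%:R /\ forall x, ratmul r x *+ q.+1 = x *+ p.+1.
Proof.
move=> r0; have := ratmulP r; have := divq_num_den r.
have := denq_gt0 r; rewrite -numq_gt0 in r0.
case: (numq r) r0 => // -[//|p] _; case: (denq r) => // -[//|q] _.
by move=> <- e; exists p, q; split.
Qed.

Lemma ratmul_ge0 r x : 0 < r -> 0 <= x -> 0 <= ratmul r x.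
Proof.
move=> /ratmul_gt0_frac[p [q [_ e]]] x0; apply: (@lg_pMn_ge0 _ _ q.+1) => //.
by rewrite e lg_mulrn_ge0.
Qed.

Lemma ratmul_disjoint r x y : 0 < r -> 0 <= x -> 0 <= y -> x \glb y = 0 ->
  x \glb ratmul r y = 0.
Proof.
move=> r0 x0 y0 xy; have ry0 := ratmul_ge0 r0 y0.
have [p [q [_ e]]] := ratmul_gt0_frac r0.
apply/le_anti; rewrite lexglb x0 ry0 !andbT.
rewrite -(lg_disjMn 1 p.+1 x0 y0 xy) mulr1n -e lexglb lg_leIl.
by rewrite (le_trans (lg_leIr _ _)) // lg_lerMn.
Qed.

End RationalMultiples.

Section Truncs.
Variable A : truncType.
Implicit Types (a b c x : A) (r : rat) (K : tkernel A).

Lemma ominus0 a : ominus a 0 = a. Proof. by rewrite /ominus /ominus_of eqxx. Qed.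

(** With [b = a / r], the element [a \ominus r] is [r] times the excess of [b] over
its truncation, so that questions about level [r] become questions about level
[1]. *)
Lemma ominusE a r : 0 < r -> 0 <= a ->
  exists b, [/\ 0 <= b, a = ratmul r b & ominus a r = ratmul r (b - trunc b)].
Proof.
move=> r0 a0; have rn0 : r != 0 by rewrite gt_eqF.
exists (ratmul r^-1 a); split; first by rewrite ratmul_ge0 // invr_gt0.
  by rewrite ratmulVK.
by rewrite ratmulB ratmulVK // /ominus /ominus_of (negbTE rn0).
Qed.

Lemma ominus_ge0 a r : 0 <= r -> 0 <= a -> 0 <= ominus a r.
Proof.
rewrite le_eqVlt => /predU1P[<-|r0] a0; first by rewrite ominus0.
have [b [b0 _ ->]] := ominusE r0 a0.
by apply: ratmul_ge0; rewrite // lg_subr_ge0 trunc_le.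
Qed.

(** Truncations are at most [1] while [b - trunc b] lives where [b > 1].  Formally,
(T1) gives [b - trunc b <= b - (b /\ trunc c)], and the right-hand side is the
negative part of [trunc c - b]. *)
Lemma trunc_excess_disjoint b c : 0 <= b -> 0 <= c ->
  lg_pos (trunc c - b) \glb (b - trunc b) = 0.
Proof.
move=> b0 c0; have bt0 : 0 <= b - trunc b by rewrite lg_subr_ge0 trunc_le.
apply/le_anti; rewrite lexglb lg_pos_ge0 bt0 !andbT -(lg_pos_disj (trunc c - b)).
rewrite lexglb lg_leIl (le_trans (lg_leIr _ _)) // opprB.
by rewrite -lg_subI lg_le2l lg_leN; have [] := truncT1 b c b0 c0.
Qed.

Lemma tkernelMn K a n : (K : set A) a -> (K : set A) (a *+ n).
Proof.
move=> Ka; elim: n => [|n IH]; first exact: kax0 (tkernel_axioms K).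
rewrite mulrS -[a *+ n]opprK -[- (a *+ n)]sub0r.
have KB := kaxB (tkernel_axioms K).
by apply: (KB) => //; apply: KB => //; exact: kax0 (tkernel_axioms K).
Qed.

Lemma tkernel_ge0_le K a x : 0 <= x -> x <= a -> (K : set A) a -> (K : set A) x.
Proof.
by move=> x0 xa Ka; apply: (kax_conv (tkernel_axioms K) Ka); exact: lg_abs_mono.
Qed.

Lemma tkernel_abs K a : (K : set A) (lg_abs a) <-> (K : set A) a.
Proof.
by split=> /(kax_conv (tkernel_axioms K)); apply;
  rewrite [lg_abs (lg_abs _)]lg_abs_id // lg_abs_ge0.
Qed.

Lemma polar_sub_ker_below a s x : 0 < s -> s < 1 ->
  polar [set ominus a s] x -> (ker_below a 1 : set A) x.
Proof.
move=> s0 s1 px; suff /tkernel_leP : polark [set ominus a s] <= ker_below a 1.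
  exact.
by apply: fsup_ub; exists s => //=; rewrite s0 s1.
Qed.

End Truncs.

(** * Cozero elements and truncation kernels *)

Section CozeroSets.
Variables (R : realType) (A : truncType) (d : Order.disp_t) (L : pframeType d).
Variable theta : A -> R0 R L.
Hypothesis tm : R0_truncation_morphism theta.
Implicit Types (a b c x y : A) (s t : R) (r : rat) (u w : L) (K : tkernel A).

Let fm a : frame_map (theta a) := r0_frame_map (theta a).

Lemma theta_up_ratmul a r t : 0 < r ->
  theta (ratmul r a) (up (ratr r * t)%R) = theta a (up t).
Proof.
move=> /(@ratmul_gt0_frac A)[p [q [-> e]]].
rewrite -(theta_upMn tm _ q) e -[RHS](theta_upMn tm _ p).
congr (theta _ (up _)); rewrite fmorph_div !rmorph_nat -[LHS]mulr_natr.
by rewrite mulrAC divfK ?pnatr_eq0 // mulr_natl.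
Qed.

Lemma theta_dn_ratmul a r t : 0 < r ->
  theta (ratmul r a) (dn (ratr r * t)%R) = theta a (dn t).
Proof.
move=> /(@ratmul_gt0_frac A)[p [q [-> e]]].
rewrite -(theta_dnMn tm _ q) e -[RHS](theta_dnMn tm _ p).
congr (theta _ (dn _)); rewrite fmorph_div !rmorph_nat -[LHS]mulr_natr.
by rewrite mulrAC divfK ?pnatr_eq0 // mulr_natl.
Qed.

Lemma theta_ominus a r : 0 <= r -> 0 <= a ->
  theta (ominus a r) (up 0) = theta a (up (ratr r)).
Proof.
rewrite le_eqVlt => /predU1P[<-|r0] a0; first by rewrite ominus0 rmorph0.
have [b [b0 -> ->]] := ominusE r0 a0.
rewrite -[0%R in LHS](mulr0 (ratr r)) theta_up_ratmul // theta_subr_trunc //.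
by rewrite -(theta_up_ratmul b 1 r0) mulr1.
Qed.

Lemma invnMn n : n.+1%:R^-1 *+ n.+1 = 1 :> R.
Proof. by rewrite -[LHS]mulr_natr mulVf ?pnatr_eq0. Qed.

Lemma invS_lt (x : R) : 0 < x -> exists n, n.+1%:R^-1 < x.
Proof. by move=> /ltr_add_invr[n]; rewrite add0r; exists n. Qed.

(** In effect, this is the kernel of [theta] followed by the frame quotient
[z |-> z \/ w].  The two archimedean conditions hold because [(0, oo)] is
exhausted by the [(1 / n, oo)]: where [x > 1 / n], the multiple [n x] exceeds [1],
and where moreover [a < m], the multiple [n m x] exceeds [a]. *)
Lemma cozero_kernel_axioms w :
  kernel_axioms [set a | theta (lg_abs a) (up 0) <= w].
Proof.
split=> /=.
- move=> x y hx hy; apply: le_trans (theta_up_le tm 0 (lg_absB x y)) _.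
  rewrite -{1}[0%R]addr0; exact: (theta_upD_le tm hx hy).
- by rewrite lg_abs0 theta0_up // le0x.
- by move=> x y hx /(theta_up_le tm 0) yx; exact: le_trans yx hx.
- move=> a a0; rewrite !lg_abs_id ?trunc_ge0 //; apply: le_trans.
  exact: theta_trunc_up.
- move=> a a0 h; rewrite lg_abs_id //.
  apply: (frame_map_join (fm a) (S := [set up n.+1%:R^-1 | n in setT])).
    by move=> x /invS_lt[n nx]; exists (up n.+1%:R^-1) => //; exists n.
  move=> _ [n _ <-]; have an0 := lg_mulrn_ge0 n.+1 a0.
  have := h n.+1 isT; rewrite lg_abs_id ?lg_subr_ge0 ?trunc_le //.
  rewrite theta_subr_trunc //; apply: le_trans.
  by rewrite -(theta_upMn tm a n) invnMn.
- move=> a x a0 x0 h; rewrite lg_abs_id //.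
  apply: (frame_map_join (fm x) (S := [set up n.+1%:R^-1 | n in setT])).
    by move=> y /invS_lt[n ny]; exists (up n.+1%:R^-1) => //; exists n.
  move=> _ [n _ <-]; rewrite -[leLHS]meetx1 -(fmap_top (fm a)).
  apply: (frame_map_cover (fm a) (S := [set dn m.+1%:R | m in setT])) => [y _|].
    exists (dn (Num.truncn y).+1%:R); first by eexists.
    exact: Num.Theory.truncnS_gt.
  move=> _ [m _ <-]; apply: le_trans (h (n.+1 * m.+1)%N).
  rewrite lg_abs_id ?lg_pos_ge0 //.
  apply: le_trans (theta_up_le tm 0 (lg_leUl _ _)).
  apply: le_trans (theta_upB tm _ _ m.+1%:R); rewrite leI2 //.
  rewrite -(theta_upMn tm x n) invnMn.
  by rewrite -(theta_upMn tm (x *+ n.+1) m) -mulrnA.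
Qed.

Definition cozero_kernel w : tkernel A :=
  TKernel ((truncation_kernelP _).2 (cozero_kernel_axioms w)).

Definition cozeros K : set L :=
  [set theta a (up 0) | a in [set a | (K : set A) a /\ 0 <= a]].

(** The adjunction which makes [K |-> fsup (cozeros K)] preserve joins. *)
Lemma cozeros_leP K w :
  (forall u, cozeros K u -> u <= w) <-> K <= cozero_kernel w.
Proof.
split=> [h|/tkernel_leP h _ [a [Ka a0] <-]]; last first.
  by have := h a Ka; rewrite /= lg_abs_id.
apply/tkernel_leP => a Ka /=; apply: h; exists (lg_abs a) => //; split.
  exact/tkernel_abs.
exact: lg_abs_ge0.
Qed.

(** Where [a < 1], the cozero element of [c] is exhausted by those of the elements
[x = (trunc (n c) - a / r)^+] with rational [r < 1].  Such an [x] is disjoint from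
[a \ominus r] by [trunc_excess_disjoint], it is at most [n c], and it is positive
where [a < r t] and [n c > t] for some [t < 1]; these conditions with varying [r],
[t] and [n] cover the region where [a < 1] and [c > 0]. *)
Lemma theta_dn1_meet_le a c w : 0 <= a -> 0 <= c ->
  (forall x, 0 <= x -> (ker_below a 1 : set A) x ->
    (forall K, (K : set A) c -> (K : set A) x) -> theta x (up 0) <= w) ->
  theta a (dn 1) `&` theta c (up 0) <= w.
Proof.
move=> a0 c0 h; rewrite meetC.
(* [v] is the product [r t] *)
pose S := [set dn v | v in [set v : R | exists r : rat, [/\ 0 < v, v < ratr r & r < 1]]].
apply: (frame_map_cover (fm a) (S := S)).
  move=> x /= x1; have /rat_in_itvoo[r] : Num.max x 0 < 1 by rewrite gt_max x1 ltr01.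
  rewrite in_itv /= gt_max => /andP[/andP[xr r0] r1].
  have [v] : exists v, Num.max x 0 < v /\ v < ratr r.
    exists ((Num.max x 0 + ratr r) / 2).
    have : Num.max x 0 < ratr r by rewrite gt_max xr r0.
    by move: (Num.max x 0) => y ?; split; lra.
  rewrite gt_max => -[/andP[xv v0] vr]; exists (dn v) => //; exists v => //.
  by exists r; split; rewrite // -(ltr_rat R) rmorph1.
move=> _ [v [r [v0 vr r1]] <-]; rewrite meetC.
have rR0 := lt_trans v0 vr; have r0 : 0 < r by rewrite -(ltr_rat R) rmorph0.
have [b [b0 ab ob]] := ominusE r0 a0.
pose t := v / ratr r.
have t0 : 0 < t by rewrite divr_gt0.
have t1 : t < 1 by rewrite ltr_pdivrMr // mul1r.
apply: (frame_map_cover (fm c) (S := [set up (t / n.+1%:R)%R | n in setT])).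
  move=> x /= x0; have /invS_lt[n nx] : 0 < x / t by rewrite divr_gt0.
  exists (up (t / n.+1%:R)); first by exists n.
  by rewrite /= mulrC -ltr_pdivlMr.
move=> _ [n _ <-]; have cn0 := lg_mulrn_ge0 n.+1 c0.
pose x := lg_pos (trunc (c *+ n.+1) - b).
apply: le_trans (h x _ _ _).
- apply: le_trans (theta_up_le tm 0 (lg_leUl _ _)).
  apply: le_trans (theta_upB tm _ _ t); rewrite meetC leI2 //.
    rewrite -(theta_upMn tm c n) -mulrnAr invnMn mulr1.
    exact: theta_trunc_up.
  by rewrite ab -(theta_dn_ratmul b t r0) mulrC divfK // gt_eqF.
- exact: lg_pos_ge0.
- apply: (polar_sub_ker_below r0 r1) => _ ->.
  rewrite !lg_abs_id ?lg_pos_ge0 ?ominus_ge0 // ?ltW // ob.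
  apply: ratmul_disjoint; rewrite ?lg_pos_ge0 ?lg_subr_ge0 ?trunc_le //.
  exact: trunc_excess_disjoint.
- move=> K /(@tkernelMn _ _ _ n.+1); apply: tkernel_ge0_le; first exact: lg_pos_ge0.
  rewrite lg_posP // lg_lerBl; apply: le_trans (trunc_le cn0) _.
  exact: lg_ler_wpDr.
Qed.

End CozeroSets.

(** * The pointed frame map induced by a truncation morphism *)

Section Lift.
Variables (R : realType) (A : truncType) (d : Order.disp_t) (L : pframeType d).
Variable theta : A -> R0 R L.
Hypothesis tm : R0_truncation_morphism theta.
Implicit Types (a b c x y : A) (s : seq A) (u w z : L) (K J : tkernel A).
Implicit Types (p q : spectrum A).

Let fm a : frame_map (theta a) := r0_frame_map (theta a).

Definition nonneg_seq s := forall b, b \in s -> 0 <= b.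

Definition ker_below_meet s : tkernel A := \meet_(b <- s) ker_below (trunc b) 1.

(** The image that every map extending [theta] must give to the meet of the
[mu (trunc b) (-oo, 1)]. *)
Definition theta_below s : L := \meet_(b <- s) theta (trunc b) (dn 1).

Definition theta_belows p : set L :=
  [set theta_below s | s in
    [set s | [/\ spec_eps p, nonneg_seq s & ker_below_meet s <= spec_ker p]]].

Definition spectrum_lift p : L :=
  fsup (cozeros theta (spec_ker p) `|` theta_belows p)%classic.

Lemma nonneg_seq_cons b s : nonneg_seq (b :: s) -> 0 <= b /\ nonneg_seq s.
Proof.
move=> bs; split=> [|x xs]; first by apply: bs; rewrite mem_head.
by apply: bs; rewrite in_cons xs orbT.
Qed.

(** Iterates [theta_dn1_meet_le] along [s]: the elements [x] found for one entry
serve as the new [c] for the next. *)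
Lemma theta_below_meet_le s c w : nonneg_seq s -> 0 <= c ->
  (forall x, 0 <= x -> (ker_below_meet s : set A) x ->
    (forall K, (K : set A) c -> (K : set A) x) -> theta x (up 0) <= w) ->
  theta_below s `&` theta c (up 0) <= w.
Proof.
elim: s c w => [|b s IH] c w; rewrite /theta_below /ker_below_meet ?big_nil ?big_cons.
  by move=> _ c0 h; rewrite meet1x; exact: h.
move=> /nonneg_seq_cons[b0 s0] c0 h; rewrite -meetA.
pose X := [set theta x (up 0) | x in [set x | [/\ 0 <= x,
  (ker_below_meet s : set A) x & forall K, (K : set A) c -> (K : set A) x]]].
apply: (@le_trans _ _ (theta (trunc b) (dn 1) `&` fsup X)).
  apply: leI2 => //; apply: IH => // x x0 sx cx.
  by apply: fsup_ub; exists x.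
apply: fmeet_fsup_le => _ [x [x0 sx cx] <-].
apply: (theta_dn1_meet_le tm) => [||y y0 yb xy] //; first exact: trunc_ge0.
by apply: h => // [|K /cx /xy //]; split=> //; exact: xy.
Qed.

(** Each entry [b] contributes the cover of the line by [(-oo, 1)] and [(0, oo)], the
second part being a cozero element. *)
Lemma theta_below_cover s z w : nonneg_seq s -> theta_below s `&` z <= w ->
  (forall c, 0 <= c -> theta c (up 0) `&` z <= w) -> z <= w.
Proof.
elim: s z => [|b s IH] z; rewrite /theta_below ?big_nil ?big_cons.
  by rewrite meet1x.
move=> /nonneg_seq_cons[b0 s0] hs h.
apply: (frame_map_cover2 (fm (trunc b)) (U := dn 1) (V := up 0)) => [x /=||].
- by have [x1|x1] := ltP x 1; [left|right; exact: lt_le_trans x1].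
- apply: IH => // [|c c0]; first
    by rewrite [z `&` _]meetC meetA [theta_below s `&` _]meetC.
  by rewrite meetA (le_trans (leIl _ _)) // h.
- by rewrite meetC h // trunc_ge0.
Qed.

Lemma spectrum_lift_ker p a : 0 <= a -> (spec_ker p : set A) a ->
  theta a (up 0) <= spectrum_lift p.
Proof. by move=> a0 pa; apply: fsup_ub; left; exists a. Qed.

Lemma spectrum_lift_below p s : spec_eps p -> nonneg_seq s ->
  ker_below_meet s <= spec_ker p -> theta_below s <= spectrum_lift p.
Proof. by move=> ep s0 sp; apply: fsup_ub; right; exists s. Qed.

Lemma spectrum_lift_least p w :
  (forall a, 0 <= a -> (spec_ker p : set A) a -> theta a (up 0) <= w) ->
  (forall s, spec_eps p -> nonneg_seq s -> ker_below_meet s <= spec_ker p ->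
    theta_below s <= w) -> spectrum_lift p <= w.
Proof.
move=> ha hs; apply: fsup_least => _ [[a [pa a0] <-]|[s [ep s0 sp] <-]].
  exact: ha.
exact: hs.
Qed.

Lemma spectrum_lift_mono p q : p <= q -> spectrum_lift p <= spectrum_lift q.
Proof.
rewrite spec_leE => /andP[epq pq]; apply: spectrum_lift_least.
  by move=> a a0 pa; apply: spectrum_lift_ker => //; move/tkernel_leP: pq; exact.
move=> s ep s0 sp; apply: spectrum_lift_below => //; last exact: le_trans pq.
by move: epq; rewrite ep; case: (spec_eps q).
Qed.

Lemma spectrum_lift_top : spectrum_lift \top = \top.
Proof.
apply/le_anti; rewrite lex1 /= (le_trans _ (@spectrum_lift_below _ [::] _ _ _)) //.
  by rewrite /theta_below big_nil.
exact: lex1.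
Qed.

(** The mixed case, a cozero element against [theta_below s], is
[theta_below_meet_le]. *)
Lemma spectrum_lift_meet : {morph spectrum_lift : p q / p `&` q}.
Proof.
move=> p q; apply/le_anti/andP; split.
  by rewrite lexI !spectrum_lift_mono ?leIl ?leIr.
have mix p' q' a s : 0 <= a -> (spec_ker p' : set A) a -> nonneg_seq s ->
    ker_below_meet s <= spec_ker q' ->
    theta_below s `&` theta a (up 0) <= spectrum_lift (p' `&` q').
  move=> a0 pa s0 sq; apply: theta_below_meet_le => // x x0 sx ax.
  apply: spectrum_lift_ker => //; split; first exact: ax.
  by move/tkernel_leP: sq; exact.
apply: fsup_fmeet_le => _ [[a [pa a0] <-]|[s [ep s0 sp] <-]];
  apply: fmeet_fsup_le => _ [[b [qb b0] <-]|[t [eq t0 tq] <-]].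
- apply: le_trans (theta_up_glb tm _ _ _) _; apply: spectrum_lift_ker.
    by rewrite lexglb a0.
  have ab0 : 0 <= a \glb b by rewrite lexglb a0.
  split; first exact: tkernel_ge0_le ab0 (lg_leIl _ _) pa.
  exact: tkernel_ge0_le ab0 (lg_leIr _ _) qb.
- by rewrite meetC; exact: mix.
- by rewrite [p `&` q]meetC; exact: mix.
- rewrite -[_ `&` _](_ : theta_below (s ++ t) = _); last first.
    by rewrite /theta_below big_cat.
  apply: spectrum_lift_below.
  + by rewrite /= ep eq.
  + by move=> b; rewrite mem_cat => /orP[/s0|/t0].
  + by rewrite /ker_below_meet big_cat leI2.
Qed.

(** The cozero elements are handled by the adjunction [cozeros_leP].  The delicate
point is an element [theta_below s] with [ker_below_meet s] below the join of the
kernels.  Some member [p] of the family has first coordinate [\top], so its image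
lies above some [theta_below t]; the rest is covered by cozero elements
[theta c (0, oo)], and on these [theta_below s] only contributes cozero elements of
the join of the kernels. *)
Lemma spectrum_lift_sup (S : set (spectrum A)) :
  spectrum_lift (fsup S) = fsup (spectrum_lift @` S).
Proof.
set w := fsup (_ @` _).
have liftw p : S p -> spectrum_lift p <= w by move=> Sp; apply: fsup_ub; exists p.
apply/le_anti/andP; split; last first.
  by apply: fsup_least => _ [p Sp <-]; rewrite spectrum_lift_mono // fsup_ub.
have kw : spec_ker (fsup S) <= cozero_kernel tm w.
  apply: fsup_least => _ [p Sp <-]; apply/cozeros_leP => _ [a [pa a0] <-].
  exact: le_trans (spectrum_lift_ker a0 pa) (liftw p Sp).
have aw a : 0 <= a -> (spec_ker (fsup S) : set A) a -> theta a (up 0) <= w.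
  by move=> a0 Sa; apply: (cozeros_leP tm _ _).2 kw _ _; exists a.
apply: spectrum_lift_least => // s /asboolP[p Sp ep] s0 sS.
have [t [t0 tp]] := spec_cond ep.
apply: (@theta_below_cover t) => // [|c c0].
  apply: le_trans (leIl _ _) (le_trans _ (liftw p Sp)).
  by apply: spectrum_lift_below; rewrite ?ep.
rewrite meetC; apply: theta_below_meet_le => // x x0 sx _; apply: aw => //.
by move/tkernel_leP: sS; exact.
Qed.

Lemma spectrum_lift_frame_map : frame_map spectrum_lift.
Proof.
split; [exact: spectrum_lift_top|exact: spectrum_lift_meet|
  exact: spectrum_lift_sup].
Qed.

Lemma pt_theta_up0 a : pt (theta a (up 0)) = false.
Proof. by rewrite r0_pt rmap_const_bot //= ltxx. Qed.

Lemma pt_theta_below s : pt (theta_below s) = true.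
Proof.
rewrite /theta_below (frame_map_bigmeet (@pt_frame_map _ L)).
elim: s => [|b s IH]; first by rewrite big_nil.
by rewrite big_cons IH r0_pt rmap_const_top /= ?ltr01.
Qed.

Lemma pt_spectrum_lift p : pt (spectrum_lift p) = pt p.
Proof.
rewrite /spectrum_lift (fmap_sup (@pt_frame_map _ L)) [RHS]/=.
apply/idP/idP => [/asboolP[_ [[a _ <-]|[s [ep _ _] <-]] xt]|ep] //.
  by move: xt; rewrite pt_theta_up0.
apply/asboolP.
have [s [s0 sp]] := spec_cond ep.
by exists (theta_below s); [right; exists s|exact: pt_theta_below].
Qed.

Definition spectrum_lift_map : pframe_map (spectrum A) L :=
  PFrameMap spectrum_lift_frame_map pt_spectrum_lift.

Lemma spectrum_lift_gen x : 0 <= x ->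
  spectrum_lift (spec_bot (gen [set x])) = theta x (up 0).
Proof.
move=> x0; apply/le_anti/andP; split; last first.
  by apply: spectrum_lift_ker => //=; exact: sub_gen.
have xk : gen [set x] <= cozero_kernel tm (theta x (up 0)).
  by apply: gen_least => _ ->; rewrite /= lg_abs_id.
apply: spectrum_lift_least => //= a a0 xa.
by apply: (cozeros_leP tm _ _).2 xk _ _; exists a.
Qed.

(** For [a >= 0] it suffices to compare upper rays, where the description of [mu]
meets [theta_ominus]; the general case follows since all maps involved respect
differences. *)
Lemma spectrum_lift_unit (mu : A -> R0 R (spectrum A)) :
  spectrum_unit mu -> forall a U, spectrum_lift (mu a U) = theta a U.
Proof.
move=> mu_unit.
have fl := spectrum_lift_frame_map.
have lmu b : frame_map (spectrum_lift \o mu b) :=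
  R0_map_frame_map spectrum_lift_map (mu b).
have pos a : 0 <= a -> spectrum_lift \o mu a = theta a.
  move=> a0; apply: frame_map_ext_rays => //= r; have [r0|r0] := leP 0 r.
    rewrite (unit_ge0 mu_unit) // spectrum_lift_gen ?ominus_ge0 //.
    exact: theta_ominus.
  rewrite (unit_lt0 mu_unit) // (fmap_top fl) theta_up_neg //.
  by rewrite -(rmorph0 (@ratr R)) ltr_rat.
move=> a U; rewrite [a]lg_posE (rmorD (unit_morphism mu_unit)) (rmorD tm).
rewrite (frame_map_rmap_op fl) pos ?lg_pos_ge0 //; congr rmap_op.
apply/funext => V; rewrite /= (rmorN (unit_morphism mu_unit)) (rmorN tm).
by rewrite -pos ?lg_pos_ge0.
Qed.

End Lift.

(** * Generation of the spectrum by the unit *)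

Section Uniqueness.
Variables (R : realType) (A : truncType) (mu : A -> R0 R (spectrum A)).
Hypothesis mu_unit : spectrum_unit mu.
Implicit Types (a b : A) (s : seq A) (K : tkernel A) (p : spectrum A).

Let fm a : frame_map (mu a) := r0_frame_map (mu a).

Lemma ray0 : ray R 0 = up 0. Proof. by rewrite /ray /up rmorph0. Qed.

Lemma unit_up0 a : 0 <= a -> mu a (up 0) = spec_bot (gen [set a]).
Proof.
by move=> a0; rewrite -ray0 (unit_ge0 mu_unit) // /ker_above ominus0.
Qed.

Lemma spec_ker_unit_frame_map a : frame_map (@spec_ker A \o mu a).
Proof.
split=> [|U V|S]; rewrite /= ?(fmap_top (fm a)) ?(fmap_meet (fm a)) //.
by rewrite (fmap_sup (fm a)) /= image_comp.
Qed.

(** [(-oo, 1)] is exhausted by the [(-oo, r)] with [0 < r < 1].  As [(-oo, r)] is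
disjoint from [(r, oo)], whose image under [mu a] is the kernel generated by
[a \ominus r], the kernel over [(-oo, r)] is contained in the polar of
[a \ominus r]. *)
Lemma spec_ker_unit_dn1 a : 0 <= a -> spec_ker (mu a (dn 1)) <= ker_below a 1.
Proof.
move=> a0; have km := spec_ker_unit_frame_map a.
apply: (frame_map_join km (U := dn 1)
  (S := [set dn (ratr r) | r in [set r : rat | (0 < r < 1)%R]])).
  move=> x /= x1; have /rat_in_itvoo[r] : Num.max x 0 < 1.
    by rewrite gt_max x1 ltr01.
  rewrite in_itv /= gt_max => /andP[/andP[xr r0] r1].
  exists (dn (ratr r)) => //; exists r => //=.
  by rewrite -!(ltr_rat R) rmorph0 rmorph1 r0.
move=> _ [r /andP[r0 r1] <-]; apply/tkernel_leP => x xr.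
apply: (polar_sub_ker_below r0 r1) => _ ->.
have /tkernel_leP : spec_ker (mu a (dn (ratr r))) `&` ker_above a r <= \bot.
  have := unit_ge0 mu_unit a0 (ltW r0) => /(congr1 (@spec_ker A)) /= <-.
  apply: (frame_map_disjoint km) => y /= yr ry.
  by have := lt_trans yr ry; rewrite ltxx.
have I0 : 0 <= lg_abs x \glb lg_abs (ominus a r) by rewrite lexglb !lg_abs_ge0.
apply; split; [apply: tkernel_ge0_le I0 (lg_leIl _ _) _|
  apply: tkernel_ge0_le I0 (lg_leIr _ _) _]; apply/tkernel_abs => //.
exact: sub_gen.
Qed.

Lemma spec_ker_theta_below s : nonneg_seq s ->
  spec_ker (theta_below mu s) <= ker_below_meet s.
Proof.
rewrite /theta_below /ker_below_meet; elim: s => [|b s IH].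
  by rewrite !big_nil lex1.
move=> /nonneg_seq_cons[b0 s0]; rewrite !big_cons /=; apply: leI2; last exact: IH.
by apply: spec_ker_unit_dn1; exact: trunc_ge0.
Qed.

(** The elements [mu a (0, oo)] generate the kernel; if the first coordinate is
[\top], the filter condition supplies an [s] whose [theta_below mu s] has first
coordinate [\top] and kernel below that of [p]. *)
Lemma spectrum_generation p :
  p = fsup (cozeros mu (spec_ker p) `|` theta_belows mu p)%classic.
Proof.
set q := fsup _; apply/le_anti/andP; split; last first.
  apply: fsup_least => _ [[a [pa a0] <-]|[s [ep s0 sp] <-]]; rewrite spec_leE.
    rewrite unit_up0 // le0x /=; apply: gen_least => _ ->; exact: pa.
  rewrite ep lex1 /=; exact: le_trans (spec_ker_theta_below s0) sp.
have qub r : (cozeros mu (spec_ker p) `|` theta_belows mu p)%classic r -> r <= q.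
  exact: fsup_ub.
rewrite spec_leE; apply/andP; split.
  case ep: (spec_eps p); last exact: le0x.
  have [s [s0 sp]] := spec_cond ep.
  have : theta_below mu s <= q by apply: qub; right; exists s.
  rewrite spec_leE => /andP[+ _]; apply: le_trans.
  by rewrite -[spec_eps _]/(pt (theta_below mu s)) pt_theta_below.
apply/tkernel_leP => a pa; apply/tkernel_abs.
have : mu (lg_abs a) (up 0) <= q.
  apply: qub; left; exists (lg_abs a) => //; split; last exact: lg_abs_ge0.
  exact/tkernel_abs.
rewrite spec_leE unit_up0 ?lg_abs_ge0 // => /andP[_ /tkernel_leP]; apply.
exact: sub_gen.
Qed.

Variables (d : Order.disp_t) (L : pframeType d).

Lemma spectrum_map_unique (g h : pframe_map (spectrum A) L) :
  (forall a U, g (mu a U) = h (mu a U)) -> g = h.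
Proof.
move=> gh; have gm := pframe_frame_map g; have hm := pframe_frame_map h.
suff : forall p, g p = h p.
  case: g h {gh gm hm} => [g gm gp] [h hm hp] /= /funext e; subst h.
  by congr PFrameMap; exact: Prop_irrelevance.
move=> p; rewrite (spectrum_generation p) (fmap_sup gm) (fmap_sup hm).
congr fsup; apply: eq_imagel => _ [[a _ <-]|[s _ <-]]; first exact: gh.
rewrite /theta_below (frame_map_bigmeet gm) (frame_map_bigmeet hm).
by apply: eq_bigr => b _; exact: gh.
Qed.

End Uniqueness.

Theorem theorem5p3p1 (R : realType) (A : truncType)
    (d : Order.disp_t) (L : pframeType d) (L_cr : completely_regular L)
    (mu : A -> R0 R (spectrum A)) (mu_unit : spectrum_unit mu)
    (theta : A -> R0 R L) (theta_mor : R0_truncation_morphism theta) :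
  exists! g : pframe_map (spectrum A) L, (R0_map g \o mu)%FUN = theta.
Proof.
have lift_mu := spectrum_lift_unit theta_mor mu_unit.
exists (spectrum_lift_map theta_mor); split.
  by apply/funext => a; apply: R0_inj => U; exact: lift_mu.
move=> g gmu; apply: (spectrum_map_unique mu_unit) => a U.
by rewrite -[RHS]/(R0_map g (mu a) U) -[R0_map g (mu a)]/((R0_map g \o mu)%FUN a)
  gmu; exact: lift_mu.
Qed.
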